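(* Let $\{G_n\}$ be a sequence of finite vertex-transitive graphs, where $G_n$ has $n$ vertices and vertex degree $d(n)\ge 3$. Fix $\lambda\in\mathbb{R}$, let $p=\frac{1+\lambda n^{-1/3}}{d(n)-1}$, and let $\mathcal{C}_1=\mathcal{C}_1(n)$ be the largest connected component of $p$-bond-percolation on $G_n$. Let $\mathbf{p}^t(v,v)$ denote the probability that the non-backtracking random walk on $G_n$ started at a vertex $v$ is at $v$ at time $t$. If $$\limsup_n\ n^{1/3}\sum_{t=1}^{n^{1/3}} t\,\mathbf{p}^t(v,v)<\infty,$$ then for any $\epsilon>0$ there exists $A=A(\epsilon,\lambda)<\infty$ such that for all $n$ (in the index set of the sequence, with $p\in[0,1]$) $$\mathbf{P}\Big(\frac{n^{2/3}}{A}\le|\mathcal{C}_1|\le A n^{2/3}\Big)\ge 1-\epsilon .$$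
   Context: Graphs are simple and undirected; they need not be connected. The index $n$ ranges over an infinite set of positive integers. $p$-bond-percolation on $G$: each edge is independently retained with probability $p$ and deleted with probability $1-p$; $\mathcal{C}_1$ is a connected component of the resulting random graph with the largest number of vertices, and $|\mathcal{C}_1|$ is its number of vertices. The non-backtracking random walk on a graph started at $v$: the first step goes to a uniformly chosen neighbor of $v$; at every later step, having just traversed an edge from $x$ to $y$, the walk moves to a uniformly chosen neighbor of $y$ other than $x$. $\mathbf{p}^t(v,v)$ is its return probability after $t$ steps; by transitivity it does not depend on $v$ (it depends on $n$). Sums with non-integer upper limits run over the integers not exceeding the limit. *)

(* Defs.v *)
From HB Require Import structures.
From mathcomp Require Import all_boot all_order all_algebra all_fingroup.

Set Implicit Arguments.
Unset Strict Implicit.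
Unset Printing Implicit Defensive.

Import Order.TTheory GRing.Theory Num.Theory.
Local Open Scope ring_scope.

Record sgraph := SGraph {
  vertex :> finType;
  adj : rel vertex;
  adj_sym : symmetric adj;
  adj_irrefl : irreflexive adj }.

Definition nbhd (G : sgraph) (x : G) : {set G} := [set y | adj x y].

Definition regular (G : sgraph) (d : nat) : Prop :=
  forall x : G, #|nbhd x| = d.

Definition vertex_transitive (G : sgraph) : Prop :=
  forall x y : G, exists s : {perm G},
    (forall u w : G, adj (s u) (s w) = adj u w) /\ s x = y.

Section Percolation.
Variables (R : numFieldType) (G : sgraph).

Definition edges : {set {set G}} :=
  [set b | [exists x : G, exists y : G, adj x y && (b == [set x; y])]].

(* A configuration is the set of retained edges. *)
Definition perc_weight (p : R) (S : {set {set G}}) : R :=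
  \prod_(b in edges) (if b \in S then p else 1 - p).

Definition perc_prob (p : R) (E : pred {set {set G}}) : R :=
  \sum_(S in powerset edges | E S) perc_weight p S.

Definition component (S : {set {set G}}) (x : G) : {set G} :=
  [set y | connect [rel u w | [set u; w] \in S] x y].

Definition largest_component_size (S : {set {set G}}) : nat :=
  \max_(x : G) #|component S x|.

End Percolation.

Section NonBacktrackingWalk.
Variables (R : numFieldType) (G : sgraph).

Definition unif_mass (A : {set G}) (y : G) : R := (y \in A)%:R / #|A|%:R.

(* [nbrw_edge v t x y] is the probability that the walk started at [v] takes
   its [t.+1]-st step from [x] to [y]. *)
Fixpoint nbrw_edge (v : G) (t : nat) (x y : G) : R :=
  if t is t'.+1 then
    \sum_(w : G) nbrw_edge v t' w x * unif_mass (nbhd x :\ w) y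
  else (x == v)%:R * unif_mass (nbhd v) y.

(* [nbrw_prob v t y] is the probability of being at [y] after [t] steps. *)
Definition nbrw_prob (v : G) (t : nat) (y : G) : R :=
  if t is t'.+1 then \sum_(x : G) nbrw_edge v t' x y else (y == v)%:R.

End NonBacktrackingWalk.

(* Main.v *)
(* Write D = d - 1 and a = n^(1/3).  Exploring a component edge by edge makes
   its size dominated by the total progeny of a Bernoulli branching walk, for
   which explicit supermartingales give the first two moments and the
   generating function.

   Upper bound: P(|C(x)| >= k) = O(1/a) at the scale k = a^2, and if the
   largest component has at least k vertices, then k vertices have a component
   of that size; conclude by Markov's inequality.

   Lower bound: by monotonicity in p one may decrease p to (1 - eps) / D with
   eps = M / a and M large.  There E|C(x)| is of order 1 / eps: the open
   non-backtracking walks of length at most r ~ 1 / eps which are simple and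
   have no open excursion have distinct endpoints, and the walks to be
   discarded are counted by closed non-backtracking walks, hence by the sum in
   the hypothesis.  Since E|C(x)|^2 = O(eps^-3) and the generating function
   bounds the contribution of small components, P(|C(x)| >= c eps^-2) is of
   order eps.  The number of such x has variance at most n E|C(x)|, so it
   vanishes with probability O(M^-3). *)
Require Import Defs.
From mathcomp Require Import all_boot all_order all_algebra all_fingroup.
From mathcomp Require Import ring lra zify.

Set Implicit Arguments.
Unset Strict Implicit.
Unset Printing Implicit Defensive.

Import Order.TTheory GRing.Theory Num.Theory.
Local Open Scope ring_scope.

(** * Bernoulli percolation on a finite set *)

Lemma set_ind_D1 (T : finType) (P : {set T} -> Prop) :
  P set0 -> (forall (E : {set T}) e, e \in E -> P (E :\ e) -> P E) ->
  forall E, P E.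
Proof.
move=> P0 PS E; move: {2}#|E| (erefl #|E|) => m.
elim: m E => [|m IHm] E cardE; first by move/cards0_eq: cardE => ->.
have /card_gt0P[e eE] : (0 < #|E|)%N by rewrite cardE.
by apply: (PS _ e) => //; apply: IHm; move: cardE; rewrite (cardsD1 e) eE => -[].
Qed.

Section Expectation.
Variables (R : realFieldType) (T : finType).
Implicit Types (p : R) (E U W S B : {set T}) (F H : {set T} -> R).

(** The edge set [E] is a parameter because the proofs reveal some edges and then average over the
    remaining ones. *)
Definition expect p E F : R :=
  \sum_(S in powerset E) (\prod_(b in E) (if b \in S then p else 1 - p)) * F S.

Lemma expect_set0 p F : expect p set0 F = F set0.
Proof. by rewrite /expect powerset0 big_set1 big_set0 mul1r. Qed.

Lemma expectD1 p E e F : e \in E ->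
  expect p E F =
    p * expect p (E :\ e) (fun S => F (e |: S)) + (1 - p) * expect p (E :\ e) F.
Proof.
move=> eE; rewrite /expect (bigID (fun S => e \in S)) /= !big_distrr /=.
congr (_ + _).
  rewrite (reindex_onto (fun S => e |: S) (fun S => S :\ e)); last first.
    by move=> S /andP[_ eS]; rewrite setD1K.
  apply: eq_big => [S|S].
    rewrite !powersetE setU11 andbT subsetD1 subUset sub1set eE /=; congr (_ && _).
    apply/eqP/idP => [<-|eS]; first by rewrite !inE eqxx.
    by rewrite setU1K.
  move=> _; rewrite (bigD1 e) //= setU11 -!mulrA; congr (_ * (_ * _)).
  rewrite [in RHS](eq_bigl (fun b => (b \in E) && (b != e))); last first.
    by move=> b; rewrite in_setD1 andbC.
  by apply: eq_bigr => b /andP[_ /negPf be]; rewrite in_setU1 be.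
apply: eq_big => [S|S].
  by rewrite !powersetE subsetD1.
move=> /andP[_ /negPf eS]; rewrite (bigD1 e) //= eS -!mulrA; congr (_ * (_ * _)).
by apply: eq_bigl => b; rewrite in_setD1 andbC.
Qed.

Lemma eq_expect p E F H : {in powerset E, F =1 H} -> expect p E F = expect p E H.
Proof. by move=> eFH; apply: eq_bigr => S SE; rewrite eFH. Qed.

Lemma expectD p E F H :
  expect p E (fun S => F S + H S) = expect p E F + expect p E H.
Proof. by rewrite /expect -big_split; apply: eq_bigr => S _; rewrite mulrDr. Qed.

Lemma expectZ p E c F : expect p E (fun S => c * F S) = c * expect p E F.
Proof. by rewrite /expect big_distrr; apply: eq_bigr => S _; rewrite mulrCA. Qed.

Lemma expectN p E F : expect p E (fun S => - F S) = - expect p E F.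
Proof. by rewrite -mulN1r -expectZ; apply: eq_expect => S _; rewrite mulN1r. Qed.

Lemma expect_sum p E (J : Type) (r : seq J) (P : pred J) (F : J -> {set T} -> R) :
  expect p E (fun S => \sum_(j <- r | P j) F j S) =
    \sum_(j <- r | P j) expect p E (F j).
Proof. by rewrite /expect exchange_big; apply: eq_bigr => S _; rewrite big_distrr. Qed.

Lemma expect_cst p E c : expect p E (fun=> c) = c.
Proof.
elim/set_ind_D1: E => [|E e eE IHE]; first by rewrite expect_set0.
by rewrite (expectD1 _ _ eE) IHE; ring.
Qed.

Lemma expectUr p U W F : [disjoint U & W] ->
  expect p (U :|: W) F =
    expect p U (fun A => expect p W (fun B => F (A :|: B))).
Proof.
elim/set_ind_D1: U F => [|U e eU IHU] F dUW.
  rewrite expect_set0 set0U; apply: eq_expect => S _ /=; by rewrite set0U.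
have eW : e \notin W by rewrite (disjointFr dUW eU).
have eUW : e \in U :|: W by rewrite in_setU eU.
have dUW' : [disjoint U :\ e & W] by apply: disjointWl dUW; exact: subD1set.
have DU : (U :|: W) :\ e = (U :\ e) :|: W.
  apply/setP => b; rewrite !inE; case: eqP => // ->.
  by rewrite (negPf eW).
rewrite (expectD1 _ _ eUW) (expectD1 _ _ eU) DU !IHU //.
by congr (_ * _ + _); apply: eq_expect => S _; apply: eq_expect => S' _; rewrite setUA.
Qed.

Lemma expect_subset p E B : B \subset E ->
  expect p E (fun S => (B \subset S)%:R) = p ^+ #|B|.
Proof.
elim/set_ind_D1: B E => [|B e eB IHB] E BE.
  rewrite cards0 expr0 -[RHS](expect_cst p E 1); apply: eq_expect => S _.
  by rewrite sub0set.
have eE := subsetP BE _ eB.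
rewrite (expectD1 _ _ eE).
rewrite (@eq_expect _ _ _ (fun S => ((B :\ e) \subset S)%:R)); last first.
  by move=> S _; rewrite subDset.
rewrite IHB ?setSD // (cardsD1 e B) eB exprS.
rewrite (@eq_expect _ _ _ (fun=> 0)) ?expect_cst ?mulr0 ?addr0 // => S.
rewrite powersetE subsetD1 => /andP[_ eS]; case: (boolP (B \subset S)) => // BS.
by rewrite (subsetP BS _ eB) in eS.
Qed.

Section Monotone.
Variable p : R.
Hypothesis p01 : 0 <= p <= 1.

Lemma le_expect E F H : (forall S, S \subset E -> F S <= H S) ->
  expect p E F <= expect p E H.
Proof.
case/andP: p01 => p0 p1 leFH; apply: ler_sum => S; rewrite powersetE => SE.
apply: ler_wpM2l; last exact: leFH.
by apply: prodr_ge0 => b _; case: ifP; rewrite ?subr_ge0.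
Qed.

Lemma expect_ge0 E F : (forall S, S \subset E -> 0 <= F S) -> 0 <= expect p E F.
Proof. by move=> F0; rewrite -(expect_cst p E 0); apply: le_expect. Qed.

Lemma le_expect_dom E W F : W \subset E ->
  {homo F : S S' / S \subset S' >-> S <= S'} -> expect p W F <= expect p E F.
Proof.
move=> WE Fmono; rewrite -(setID E W) setUC expectUr; last first.
  rewrite -setI_eq0; apply/eqP/setP => b.
  by rewrite !inE; case: (b \in W); rewrite ?andbF.
rewrite (setIidPr WE) -[leLHS](expect_cst p (E :\: W)); apply: le_expect => S _.
by apply: le_expect => S' _; apply: Fmono; rewrite subsetUr.
Qed.

End Monotone.

(** Induction on the edges takes the place of a monotone coupling: opening [e] increases [F], so
    raising the parameter of [e] alone raises the expectation. *)
Lemma le_expect_param p q E F : 0 <= p -> p <= q -> q <= 1 ->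
  {homo F : S S' / S \subset S' >-> S <= S'} -> expect p E F <= expect q E F.
Proof.
move=> p0 pq q1; have p1 := le_trans pq q1.
elim/set_ind_D1: E F => [|E e eE IHE] F Fmono; first by rewrite !expect_set0.
rewrite !(expectD1 _ _ eE).
have IH1 := IHE _ Fmono.
have /IHE IH2 : {homo (fun S => F (e |: S)) : S S' / S \subset S' >-> S <= S'}.
  by move=> S S' SS'; apply: Fmono; rewrite setUS.
have : expect p (E :\ e) F <= expect p (E :\ e) (fun S => F (e |: S)).
  apply: le_expect; first by rewrite p0.
  by move=> S _; apply: Fmono; rewrite subsetUr.
move: IH1 IH2; set a := expect p _ _; set b := expect q _ _.
set c := expect p _ _; set d := expect q _ _ => ab cd ac.
(* First the parameter of [e] moves from [p] to [q], then that of the other edges. *)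
have : p * c + (1 - p) * a <= q * c + (1 - q) * a by nra.
have : q * c + (1 - q) * a <= q * d + (1 - q) * b by nra.
by move=> /[swap]; exact: le_trans.
Qed.

End Expectation.

(** * Components and their exploration *)

Section Components.
Variable G : sgraph.
Implicit Types (S E : {set {set G}}) (D A B : {set G}) (x y z u w : G).

Definition edge_closed S B := forall u w, u \in B -> [set u; w] \in S -> w \in B.

Lemma component_refl S x : x \in component S x.
Proof. by rewrite inE connect0. Qed.

Lemma component_closed S x : edge_closed S (component S x).
Proof.
move=> u w; rewrite !inE => xu uw.
by apply: (connect_trans xu); apply: connect1.
Qed.

Lemma component_minimal S x B :
  x \in B -> edge_closed S B -> component S x \subset B.
Proof.
move=> xB Bcl; apply/subsetP => y; rewrite inE => /connectP[s pth ->].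
elim: s x xB pth => //= u s IHs x xB /andP[xu pth].
exact: IHs (Bcl _ _ xB xu) pth.
Qed.

Lemma component_sym S x y : (y \in component S x) = (x \in component S y).
Proof.
rewrite !inE; apply: sym_connect_sym => u w /=; by rewrite setUC.
Qed.

Lemma subset_component S S' x :
  S \subset S' -> component S x \subset component S' x.
Proof.
move=> SS'; apply: component_minimal; first exact: component_refl.
by move=> u w uC uw; apply: component_closed uC _; exact: subsetP uw.
Qed.

Lemma component_eq S x y : y \in component S x -> component S y = component S x.
Proof.
have sub u w : w \in component S u -> component S w \subset component S u.
  by move=> wu; apply: component_minimal => //; exact: component_closed.
by move=> yx; apply/eqP; rewrite eqEsubset !sub // -component_sym.
Qed.

(** The exploration restarts from the whole set of vertices reached so far, hence a union of
    components. *)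
Definition cluster S D : {set G} := \bigcup_(x in D) component S x.

Lemma cluster1 S x : cluster S [set x] = component S x.
Proof. by rewrite /cluster big_set1. Qed.

Lemma cluster_sub S D B :
  D \subset B -> edge_closed S B -> cluster S D \subset B.
Proof.
move=> DB Bcl; apply/bigcupsP => x xD.
by apply: component_minimal Bcl; apply: subsetP xD.
Qed.

Lemma sub_cluster S D : D \subset cluster S D.
Proof. by apply/subsetP => x xD; apply/bigcupP; exists x => //; exact: component_refl. Qed.

Lemma cluster_closed S D : edge_closed S (cluster S D).
Proof.
move=> u w /bigcupP[x xD uC] uw; apply/bigcupP; exists x => //.
exact: component_closed uC uw.
Qed.

Lemma set2_eq x y z u : [set x; y] = [set z; u] ->
  (x = z /\ y = u) \/ (x = u /\ y = z).
Proof.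
move=> E.
have : x \in [set z; u] by rewrite -E set21.
have : y \in [set z; u] by rewrite -E set22.
have : z \in [set x; y] by rewrite E set21.
have : u \in [set x; y] by rewrite E set22.
rewrite !inE => uxy zxy yzu xzu.
case/orP: xzu uxy zxy => /eqP->; case/orP: yzu => /eqP->; rewrite ?orbb; try by tauto.
- by move=> /eqP->; left.
- by move=> _ /eqP->; left.
Qed.

Definition boundary E D : {set {set G}} :=
  [set e in E | [exists w in D, exists z, (z \notin D) && (e == [set w; z])]].

Definition incident E z : {set {set G}} := [set e in E | z \in e].

(** An open edge from [D] to [z] may be forgotten once [z] counts as reached. *)
Lemma cluster_add S D w z : w \in D ->
  cluster ([set w; z] |: S) D \subset cluster S (z |: D).
Proof.
move=> wD; have zwD := sub_cluster S (z |: D).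
apply: cluster_sub; first exact: subset_trans (subsetUr _ _) zwD.
move=> u t uC; rewrite in_setU1 => /orP[/eqP/set2_eq|]; last exact: cluster_closed.
by case=> -[_ ->]; apply: (subsetP zwD); rewrite !inE ?eqxx ?wD ?orbT.
Qed.

Lemma boundary_add E D w z e : e \in boundary E D -> e = [set w; z] ->
  boundary (E :\ e) (z |: D) \subset (boundary E D :\ e) :|: (incident E z :\ e).
Proof.
move=> eB def_e; apply/subsetP => b; rewrite !inE -andbA => /and3P[be bE].
rewrite be bE /= => /existsP[u /andP[uD /existsP[t /andP[tD /eqP def_b]]]].
move: uD tD; rewrite !inE negb_or => /orP[/eqP uz|uD] /andP[tz tD].
  by rewrite def_b uz !inE eqxx orbT.
by apply/orP; left; apply/existsP; exists u; rewrite uD; apply/existsP; exists t; rewrite tD def_b eqxx.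
Qed.

End Components.

Section Exploration.
Variables (R : realFieldType) (G : sgraph) (p : R) (d : nat).
Hypothesis p01 : 0 <= p <= 1.
Variables (f : nat -> R) (Phi : nat -> nat -> R).
Hypothesis f_mono : {homo f : i j / (i <= j)%N >-> i <= j}.
Hypothesis Phi_mono : forall j, {homo Phi^~ j : m k / (m <= k)%N >-> m <= k}.
Hypothesis f_le_Phi : forall m j, f j <= Phi m j.
Hypothesis Phi_super : forall m j,
  p * Phi (m + d.-1)%N j.+1 + (1 - p) * Phi m j <= Phi m.+1 j.

(* The cluster of [D] is explored one boundary edge at a time: a closed edge
   lowers the number of edges still to be queried by one, an open one adds one
   vertex together with at most [d.-1] new edges. *)
Lemma expect_cluster_le (E : {set {set G}}) (D : {set G}) (m : nat) :
  (forall z, (#|incident E z| <= d)%N) -> (#|boundary E D| <= m)%N ->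
  expect p E (fun S => f #|cluster S D|) <= Phi m #|D|.
Proof.
move: {2}#|E| (leqnn #|E|) => k.
elim: k E D m => [|k IHk] E D m cardE degE bd;
    have [bd0|[e eB]] := set_0Vmem (boundary E D).
(* Without boundary edges no open edge leaves [D], so the exploration has ended. *)
1,3: rewrite -[leRHS](expect_cst p E); apply: le_expect => // S SE;
  apply: le_trans (f_le_Phi _ _); apply: f_mono; apply: subset_leq_card;
  apply: cluster_sub => // u w uD uw; apply: contraT => wD;
  have := in_set0 [set u; w]; rewrite -bd0 inE (subsetP SE _ uw) /=;
  move=> /existsP[]; exists u; rewrite uD; apply/existsP; exists w;
  by rewrite wD eqxx.
  move: eB; rewrite inE => /andP[].
  by move: cardE; rewrite leqn0 cards_eq0 => /eqP->; rewrite inE.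
have eE : e \in E by move: eB; rewrite inE => /andP[].
have := eB; rewrite inE => /andP[_ /existsP[w /andP[wD /existsP[z /andP[zD /eqP def_e]]]]].
have cardE' : (#|E :\ e| <= k)%N by move: cardE; rewrite (cardsD1 e E) eE.
have degE' y : (#|incident (E :\ e) y| <= d)%N.
  apply: leq_trans (degE y); apply: subset_leq_card; apply/subsetP => b.
  by rewrite !inE => /andP[/andP[_ ->] ->].
case: m bd => [|m] bd; first by move: bd; rewrite leqn0 cards_eq0 => /eqP bd0; rewrite bd0 inE in eB.
have cardB : (#|boundary E D :\ e| <= m)%N by move: bd; rewrite (cardsD1 e (boundary _ _)) eB.
(* The edge [e] is itself incident to [z] and has just been queried, hence [d.-1]. *)
have cardI : (#|incident E z :\ e| <= d.-1)%N.
  have := degE z; rewrite (cardsD1 e (incident _ _)) inE eE def_e !inE eqxx orbT /=.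
  by case: (d).
rewrite (expectD1 _ _ eE); apply: le_trans (Phi_super _ _).
have [p0 p1] := andP p01.
apply: lerD; apply: ler_wpM2l; rewrite ?subr_ge0 //.
  rewrite -[X in Phi _ X]/(1 + #|D|)%N.
  have -> : (1 + #|D|)%N = #|z |: D| by rewrite cardsU1 zD.
  apply: le_trans (IHk _ (z |: D) _ cardE' degE' _).
    apply: le_expect => // S _; apply: f_mono; apply: subset_leq_card.
    by rewrite def_e; exact: cluster_add.
  apply: leq_trans (subset_leq_card (boundary_add eB def_e)) _.
  apply: leq_trans (leq_card_setU _ _) _; exact: leq_add.
apply: IHk => //; apply: leq_trans cardB; apply: subset_leq_card.
by apply/subsetP => b; rewrite !inE => /andP[/andP[-> ->]].
Qed.

End Exploration.

(** * Moments of the size of a component *)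

(** By induction: [1 - u] times the bound for [n] exceeds the bound for [n + 1] by
    [n (n - 1) (n - 2) u ^ 4 / 6], which is nonnegative for natural [n]. *)
Lemma Bonferroni_exp (R : realFieldType) (u : R) (n : nat) : 0 <= u <= 1 ->
  1 - n%:R * u + n%:R * (n%:R - 1) / 2 * u ^+ 2
    - n%:R * (n%:R - 1) * (n%:R - 2) / 6 * u ^+ 3 <= (1 - u) ^+ n.
Proof.
move=> /andP[u0 u1]; elim: n => [|n IHn]; first by rewrite expr0; lra.
have n3 : 0 <= n%:R * (n%:R - 1) * (n%:R - 2) :> R.
  case: n {IHn} => [|[|n]]; rewrite ?mul0r ?subrr ?mulr0 ?mul0r //.
  rewrite -!natr1; have : 0 <= n%:R :> R by [].
  by move: n%:R => m m0; rewrite !mulr_ge0 //; lra.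
have u1' : 0 <= 1 - u by rewrite subr_ge0.
rewrite [leRHS]exprS; apply: (le_trans _ (ler_wpM2l u1' IHn)).
rewrite -subr_ge0 -(natr1 n).
set D := n%:R in n3 *.
have -> : (1 - u) * (1 - D * u + D * (D - 1) / 2 * u ^+ 2
    - D * (D - 1) * (D - 2) / 6 * u ^+ 3)
  - (1 - (D + 1) * u + (D + 1) * (D + 1 - 1) / 2 * u ^+ 2
    - (D + 1) * (D + 1 - 1) * (D + 1 - 2) / 6 * u ^+ 3)
  = D * (D - 1) * (D - 2) * u ^+ 4 / 6 by field.
by rewrite divr_ge0 // mulr_ge0 ?exprn_ge0.
Qed.

(** The gain of order [eta ^ 2] over [1 - eta] gives room, in the generating function below, both to
    count vertices and to let [p] slightly exceed [1 / D]. *)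
Lemma ge_expr_quadratic (R : realFieldType) (eta : R) (D : nat) :
  0 <= eta <= 1 -> (2 <= D)%N ->
  1 - eta + eta ^+ 2 / 8 <= (1 - eta / D%:R) ^+ D.
Proof.
move=> /andP[e0 e1] D2.
have D2' : 2 <= D%:R :> R by rewrite ler_nat.
have D0 : 0 < D%:R :> R by lra.
set u := eta / D%:R.
have uD : eta = D%:R * u by rewrite /u mulrC divfK ?gt_eqF.
have u0 : 0 <= u by rewrite divr_ge0 // ltW.
have u1 : u <= 1 by move: uD u0 D2'; clearbody u; move: D%:R => x *; nra.
apply: (le_trans _ (Bonferroni_exp _ _)); last by rewrite u0.
rewrite -subr_ge0.
move: uD u0 u1 D2' D0; set x := D%:R => uD u0 u1 D2' D0.
have -> : 1 - x * u + x * (x - 1) / 2 * u ^+ 2 - x * (x - 1) * (x - 2) / 6 * u ^+ 3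
   - (1 - eta + eta ^+ 2 / 8) =
   x * u ^+ 2 * ((x - 1) / 2 * (1 - (x - 2) * u / 3) - x / 8) by rewrite uD; field.
apply: mulr_ge0; first by rewrite mulr_ge0 ?exprn_ge0 // ltW.
(* As [(x - 2) u <= 1], the last factor is at least [(x - 1) / 3 - x / 8], nonnegative for
   [x >= 2]. *)
nra.
Qed.

(** Induction on [(1 - t) (1 + (n + 1) t) <= 1 + n t]. This reads off tails at the scale [1 / t]
    from the generating function. *)
Lemma bernoulli_inv (R : realFieldType) (t : R) (n : nat) : 0 <= t <= 1 ->
  (1 - t) ^+ n <= (1 + n%:R * t)^-1.
Proof.
move=> /andP[t0 t1].
have h0 : 0 <= 1 - t by rewrite subr_ge0.
have p0 : 0 < 1 + n%:R * t by rewrite ltr_wpDr // mulr_ge0.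
rewrite -[leRHS]mul1r ler_pdivlMr //.
elim: n p0 => [|n IHn] _; first by rewrite expr0; lra.
have pn : 0 < 1 + n%:R * t by rewrite ltr_wpDr // mulr_ge0.
have {}IHn := IHn pn; have e0 : 0 <= (1 - t) ^+ n by exact: exprn_ge0.
have n0 : 0 <= n%:R :> R by [].
rewrite exprS -natr1; apply: le_trans IHn.
rewrite -mulrA mulrCA; apply: ler_wpM2l => //.
nra.
Qed.

Section ClusterMoments.
Variables (R : realFieldType) (G : sgraph) (D : nat).
Hypothesis regG : regular G D.+1.
Hypothesis D2 : (2 <= D)%N.

Lemma card_incident_edges (z : G) : (#|incident (edges G) z| <= D.+1)%N.
Proof.
rewrite -(regG z); apply: leq_trans (leq_imset_card (fun y => [set z; y]) (nbhd z)).
apply: subset_leq_card; apply/subsetP => e; rewrite !inE => /andP[].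
move=> /existsP[x /existsP[y /andP[xy /eqP->]]]; rewrite !inE => /orP[]/eqP->.
  by apply: imset_f; rewrite inE.
by rewrite setUC; apply: imset_f; rewrite inE adj_sym.
Qed.

Lemma expect_component_le (p : R) (f : nat -> R) (Phi : nat -> nat -> R) (x : G) :
  0 <= p <= 1 ->
  {homo f : i j / (i <= j)%N >-> i <= j} ->
  (forall j, {homo Phi^~ j : m k / (m <= k)%N >-> m <= k}) ->
  (forall m j, f j <= Phi m j) ->
  (forall m j, p * Phi (m + D)%N j.+1 + (1 - p) * Phi m j <= Phi m.+1 j) ->
  expect p (edges G) (fun S => f #|component S x|) <= Phi D.+1 1%N.
Proof.
move=> p01 f_mono Phi_mono fPhi Phi_super.
rewrite (@eq_expect _ _ _ _ _ (fun S => f #|cluster S [set x]|)); last first.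
  by move=> S _; rewrite cluster1.
rewrite -(cards1 x).
apply: (@expect_cluster_le _ _ _ D.+1) => //; first exact: card_incident_edges.
apply: leq_trans (card_incident_edges x); apply: subset_leq_card.
apply/subsetP => e; rewrite !inE => /andP[-> /existsP[w]] /=.
by rewrite inE => /andP[/eqP-> /existsP[z /andP[_ /eqP->]]]; rewrite !inE eqxx.
Qed.

Let D2R : 2 <= D%:R :> R. Proof. by rewrite ler_nat. Qed.

Section Subcritical.
Variables (p eps : R).
Hypothesis p0 : 0 <= p.
Hypothesis eps0 : 0 < eps.
Hypothesis p_def : p * D%:R = 1 - eps.

Let p01 : 0 <= p <= 1. Proof. by rewrite p0 /=; have := D2R; move: p_def eps0; move: D%:R => y *; nra. Qed.

Lemma expect_component_card (x : G) :
  expect p (edges G) (fun S => #|component S x|%:R) <= 1 + D.+1%:R * (p / eps).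
Proof.
(* Each unqueried edge is charged [a = p / eps], the solution of [a = p (1 + D a)]: the mean progeny
   behind an edge of the branching walk. *)
pose Phi (m j : nat) : R := j%:R + m%:R * (p / eps).
have a0 : 0 <= p / eps by rewrite divr_ge0 // ltW.
have ae : p / eps * eps = p by rewrite divfK ?gt_eqF.
apply: (@expect_component_le p (fun j => j%:R) Phi) => //.
- by move=> i j ij; rewrite ler_nat.
- by move=> j m k mk; rewrite /Phi lerD2l ler_wpM2r // ler_nat.
- by move=> m j; rewrite lerDl mulr_ge0.
move=> m j; rewrite /Phi natrD -!natr1; move: (p / eps) a0 ae p_def => a a0 ae; move: D%:R j%:R m%:R => y J m' pd.
have : p * y * a = (1 - eps) * a by rewrite pd.
nra.
Qed.

Lemma expect_component_card_sqr (x : G) :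
  expect p (edges G) (fun S => #|component S x|%:R ^+ 2) <=
    (1 + D.+1%:R * (p / eps)) ^+ 2 + D.+1%:R * (p / eps ^+ 3).
Proof.
(* Here [a] is the mean progeny behind an edge and [b] bounds its variance. The exact variance times
   [eps] is [p (1 + a D) ^ 2 - a ^ 2]; dropping [a ^ 2] produces the defect [a ^ 2] found at the
   end. *)
pose a := p / eps; pose b := p / eps ^+ 3.
pose Phi (m j : nat) : R := (j%:R + m%:R * a) ^+ 2 + m%:R * b.
have a0 : 0 <= a by rewrite divr_ge0 // ltW.
have b0 : 0 <= b by rewrite divr_ge0 // exprn_ge0 // ltW.
have ae : a * eps = p by rewrite divfK ?gt_eqF.
have aD : eps * (1 + a * D%:R) = 1.
  by rewrite mulrDr mulr1 mulrA (mulrC eps) ae p_def; ring.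
have be : b * eps = p * (1 + a * D%:R) ^+ 2.
  have -> : 1 + a * D%:R = eps^-1 by rewrite -[LHS](mulKf (lt0r_neq0 eps0)) aD mulr1.
  by rewrite /b; field; rewrite gt_eqF.
rewrite -/a -/b; clearbody a b.
apply: (@expect_component_le p (fun j => j%:R ^+ 2) Phi) => //.
- by move=> i j ij; apply: lerXn2r; rewrite ?ler_nat ?nnegrE.
- move=> j m k mk; rewrite /Phi lerD ?ler_wpM2r ?ler_nat //.
  apply: lerXn2r; rewrite ?nnegrE ?addr_ge0 ?mulr_ge0 //.
  by rewrite lerD2l ler_wpM2r ?ler_nat.
- move=> m j; rewrite /Phi -[leLHS]addr0 lerD ?mulr_ge0 //.
  by apply: lerXn2r; rewrite ?nnegrE ?addr_ge0 ?mulr_ge0 ?lerDl ?mulr_ge0.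
move=> m j; rewrite /Phi natrD -!natr1.
move: (j%:R) (m%:R) => J m'; rewrite -subr_ge0.
have pa : p * (1 + a * D%:R) = a.
  by rewrite -ae -mulrA aD mulr1.
set X := J + (m' + 1) * a.
suff -> : X ^+ 2 + (m' + 1) * b
   - (p * ((J + 1 + (m' + D%:R) * a) ^+ 2 + (m' + D%:R) * b)
      + (1 - p) * ((J + m' * a) ^+ 2 + m' * b)) = a ^+ 2.
  by rewrite exprn_ge0.
have -> : J + 1 + (m' + D%:R) * a = X - a + (1 + a * D%:R) by rewrite /X; ring.
have -> : J + m' * a = X - a by rewrite /X; ring.
transitivity (a ^+ 2 + 2 * (X - a) * (a - p * (1 + a * D%:R))
   + b * (1 - p * D%:R) - p * (1 + a * D%:R) ^+ 2); first by ring.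
by rewrite -be pa p_def; ring.
Qed.

End Subcritical.

Lemma expect_component_genfun (p eta : R) (x : G) :
  0 <= p <= 1 -> 0 < eta <= 1 -> p * D%:R <= 1 + eta / 16 ->
  expect p (edges G) (fun S => 1 - (1 - eta ^+ 2 / 16) ^+ #|component S x|)
    <= 2 * eta.
Proof.
move=> p01 /andP[e0 e1] pD; have [p0 p1] := andP p01.
have D0 : 0 < D%:R :> R by apply: lt_le_trans D2R.
pose u := eta / D%:R; pose t := eta ^+ 2 / 16.
have t0 : 0 <= t by rewrite divr_ge0 ?exprn_ge0 // ltW.
have te : t <= eta / 16 by rewrite /t expr2; nra.
have t1 : t <= 1 / 16 by lra.
have u0 : 0 <= u by rewrite divr_ge0 // ltW.
have uD : u * D%:R = eta by rewrite divfK ?gt_eqF.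
have ue : u <= eta / 2.
  by move: uD u0 D2R; clearbody u; move: D%:R => y *; nra.
have u1 : u <= 1 by lra.
(* If vertices are marked with probability [t] and each unqueried edge leads to a mark with
   probability [u], this is the probability of some mark. The supermartingale property becomes
   [p (1 - (1 - t) (1 - u) ^ D) <= u]. *)
pose Phi (m j : nat) : R := 1 - (1 - u) ^+ m * (1 - t) ^+ j.
have x01 : 0 <= 1 - u <= 1 by lra.
have y01 : 0 <= 1 - t <= 1 by lra.
have [x0 x1] := andP x01; have [y0 y1] := andP y01.
apply: (@le_trans _ _ (Phi D.+1 1%N)).
  apply: (@expect_component_le p (fun j => 1 - (1 - t) ^+ j) Phi) => //.
  - by move=> i j ij; rewrite lerB // ler_wiXn2l.
  - move=> j m k mk; rewrite lerB // ler_wpM2r ?exprn_ge0 //.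
    by rewrite ler_wiXn2l.
  - move=> m j; rewrite lerB // ler_piMl ?exprn_ge0 // exprn_ile1 //.
  move=> m j; rewrite /Phi exprD !exprS.
  have := ge_expr_quadratic (D := D) (eta := eta); rewrite e1 ltW // -/u => /(_ isT D2).
  set q := (1 - u) ^+ D => q_ge.
  set M := (1 - u) ^+ m; set N := (1 - t) ^+ j.
  have MN0 : 0 <= M * N by rewrite mulr_ge0 ?exprn_ge0.
  rewrite -subr_ge0.
  have -> : 1 - (1 - u) * M * N - (p * (1 - M * q * ((1 - t) * N)) + (1 - p) * (1 - M * N))
     = (M * N) * (p * (q * (1 - t)) - p + u) by ring.
  apply: mulr_ge0 => //.
  have q1 : q <= 1 by exact: exprn_ile1.
  have h : 1 - eta + eta ^+ 2 / 16 <= q * (1 - t).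
    have -> : q * (1 - t) = q - q * t by ring.
    have : q * t <= t by rewrite ler_piMl.
    rewrite {2}/t; lra.
  (* After multiplication by [D], what remains is [(1 + eta / 16) (1 - eta / 16) <= 1]. *)
  have := ler_wpM2l p0 h; rewrite -(ler_pM2r D0) => h2.
  rewrite -(pmulr_lge0 _ D0).
  rewrite mulrDl uD mulrBl; nra.
rewrite /Phi expr1.
have q_ge := ge_expr_quadratic (D := D) (eta := eta); rewrite e1 ltW // -/u in q_ge.
have {}q_ge := q_ge isT D2.
rewrite exprS; move: q_ge; set q := (1 - u) ^+ D => q_ge.
have q1 : 1 - eta <= q by nra.
have h1 : (1 - u) * (1 - eta) <= (1 - u) * q by rewrite ler_wpM2l.
have h2 : 1 - u - eta <= (1 - u) * q by nra.
have h3 : (1 - u) * q <= 1 by rewrite mulr_ile1 ?exprn_ge0 ?exprn_ile1.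
have : (1 - u) * q * t <= t by rewrite ler_piMl.
by rewrite mulrBr mulr1; lra.
Qed.

End ClusterMoments.

(** * Second moment of the number of large components *)

Lemma ler_bool (R : numDomainType) (b c : bool) : (b -> c) -> b%:R <= c%:R :> R.
Proof. by case: b => [->|] //; rewrite ler0n. Qed.

Section SecondMoment.
Variables (R : realFieldType) (G : sgraph) (p : R) (E : {set {set G}}).
Hypothesis p01 : 0 <= p <= 1.
Implicit Types (x y : G) (A : {set G}) (S : {set {set G}}) (k : nat).

Lemma component_setU_away (S1 S2 : {set {set G}}) A x :
  (forall e, e \in S2 -> [disjoint e & A]) -> component S1 x \subset A ->
  component (S1 :|: S2) x = component S1 x.
Proof.
move=> S2A S1A; apply/eqP; rewrite eqEsubset andbC subset_component ?subsetUl //=.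
apply: component_minimal; first exact: component_refl.
move=> u w uC; rewrite in_setU => /orP[|/S2A]; first exact: component_closed.
by move=> /disjointFr/(_ (set21 u w)); rewrite (subsetP S1A _ uC).
Qed.

(* Given that the component of [x] is [A], the component of [y] is determined
   by the edges which do not meet [A]. *)
Lemma expect_component_disjoint x y A k : y \notin A ->
  expect p E (fun S => (component S x == A)%:R * (k <= #|component S y|)%N%:R)
  <= expect p E (fun S => (component S x == A)%:R) *
     expect p E (fun S => (k <= #|component S y|)%N%:R).
Proof.
move=> yA; pose W := [set e in E | [disjoint e & A]].
have dEW : [disjoint E :\: W & W].
  by rewrite -setI_eq0; apply/eqP/setP => b; rewrite !inE; case: (b \in E); case: [disjoint _ & _].
have EU : E = (E :\: W) :|: W.
  by apply/setP => b; rewrite !inE; case: (b \in E); case: [disjoint _ & _].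
(* Whether the component of [x] is [A] does not depend on the edges of [W], which avoid [A]. *)
have SA (S1 S2 : {set {set G}}) : S2 \subset W ->
    (component (S1 :|: S2) x == A) = (component S1 x == A).
  move=> S2W.
  have S2A e : e \in S2 -> [disjoint e & A].
    by move=> /(subsetP S2W); rewrite inE => /andP[].
  apply/eqP/eqP => [CA|CA].
    rewrite -[RHS]CA (component_setU_away S2A) // -CA.
    by rewrite subset_component ?subsetUl.
  by rewrite (component_setU_away S2A) // CA.
have probA : expect p E (fun S => (component S x == A)%:R) =
    expect p (E :\: W) (fun S => (component S x == A)%:R).
  rewrite {1}EU expectUr //; apply: eq_expect => S1 _.
  rewrite -[RHS](expect_cst p W); apply: eq_expect => S2.
  by rewrite powersetE => /SA->.
rewrite probA {1}EU expectUr // mulrC -expectZ.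
apply: le_expect => // S1 S1W.
apply: (@le_trans _ _ (expect p W (fun S2 =>
    (component S1 x == A)%:R * (k <= #|component S2 y|)%N%:R))).
  apply: le_expect => // S2 S2W; rewrite SA //.
  have [CA|_] := eqVneq; last by rewrite !mul0r.
  rewrite !mul1r; apply: ler_bool => /leq_trans; apply; apply: subset_leq_card.
  have S2A e : e \in S2 -> [disjoint e & A].
    by move=> /(subsetP S2W); rewrite inE => /andP[].
  have CA' : component (S1 :|: S2) x = A.
    by rewrite (component_setU_away S2A) CA.
  apply: component_minimal; first exact: component_refl.
  move=> u w uC; rewrite in_setU => /orP[uwS1|]; last exact: component_closed.
  (* No open edge leaves [A], and an edge of [S1] meets [A]; so both its ends lie in [A], where the
     component of [y] cannot go. *)
  have wA : (w \in A) = (u \in A).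
    have cl := @component_closed _ (S1 :|: S2) x.
    rewrite -CA'; apply/idP/idP => [wC|uC']; last by apply: cl uC' _; rewrite inE uwS1.
    by apply: cl wC _; rewrite setUC inE uwS1.
  have uA : u \in A.
    have /setDP[uwE] := subsetP S1W _ uwS1.
    rewrite inE uwE /= => /pred0Pn[z /andP[/=]].
    by rewrite !inE => /orP[]/eqP-> //; rewrite wA.
  have uCy : u \in component (S1 :|: S2) y.
    by apply: subsetP uC; rewrite subset_component ?subsetUr.
  by case/negP: yA; rewrite -CA' -(component_eq (y := u)) ?CA' // component_sym.
rewrite expectZ mulrC; apply: ler_wpM2r => //.
apply: le_expect_dom => //; first by apply/subsetP => e; rewrite inE => /andP[].
move=> S S' SS'; apply: ler_bool => /leq_trans; apply; apply: subset_leq_card.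
exact: subset_component.
Qed.

(** All positive correlation is charged to pairs in a common component; otherwise one sums over the
    possible components [A] of [x], which miss [y]. *)
Lemma expect_two_large x y k :
  expect p E (fun S => (k <= #|component S x|)%N%:R * (k <= #|component S y|)%N%:R)
  <= expect p E (fun S => (y \in component S x)%:R) +
     expect p E (fun S => (k <= #|component S x|)%N%:R) *
     expect p E (fun S => (k <= #|component S y|)%N%:R).
Proof.
pose P A := (k <= #|A|)%N && (y \notin A).
set q := expect p E (fun S => (k <= #|component S y|)%N%:R).
have q0 : 0 <= q by apply: expect_ge0.
apply: (@le_trans _ _ (expect p E (fun S => (y \in component S x)%:R +
  \sum_(A | P A) (component S x == A)%:R * (k <= #|component S y|)%N%:R))).
  apply: le_expect => // S _.
  have sum0 : 0 <= \sum_(A | P A)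
      (component S x == A)%:R * (k <= #|component S y|)%N%:R :> R.
    by apply: sumr_ge0 => A _; rewrite mulr_ge0.
  have [yC|yC] := boolP (y \in component S x).
    apply: ler_wpDr => //; rewrite -natrM -[leRHS]/(1%:R) ler_nat.
    by rewrite mulnb leq_b1.
  have [xk|xk] := leqP k #|component S x|; last by rewrite mul0r addr_ge0.
  by rewrite add0r (bigD1 (component S x)) /P ?xk //= eqxx lerDl sumr_ge0 // => A _; rewrite mulr_ge0.
rewrite expectD lerD2l expect_sum.
apply: (@le_trans _ _ (\sum_(A | P A) expect p E (fun S => (component S x == A)%:R) * q)).
  by apply: ler_sum => A /andP[_ yA]; exact: expect_component_disjoint.
rewrite -big_distrl /= ler_wpM2r // -expect_sum; apply: le_expect => // S _.
have [PC|PC] := boolP (P (component S x)).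
  rewrite (bigD1 (component S x)) //= eqxx big1 ?addr0; first by case/andP: PC => ->.
  by move=> A /andP[_]; rewrite eq_sym => /negPf->.
rewrite big1 // => A PA; case: eqP => // CA.
by rewrite CA PA in PC.
Qed.

(** Chebyshev's inequality for the number [N] of vertices in large components. Summed over [y], the
    probabilities of sharing the component of [x] give its mean size, so the variance of [N] is at
    most [#|G| * chi]. *)
Lemma second_moment_method k (q chi : R) : (0 < #|G|)%N -> 0 <= q ->
  (forall x, q <= expect p E (fun S => (k <= #|component S x|)%N%:R)) ->
  (forall x, expect p E (fun S => #|component S x|%:R) <= chi) ->
  #|G|%:R * q ^+ 2 * expect p E (fun S => [forall x, (#|component S x| < k)%N]%:R)
    <= chi.
Proof.
move=> G0 q0 q_le le_chi; set P0 := expect p E _.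
have P00 : 0 <= P0 by apply: expect_ge0.
pose L S x : R := (k <= #|component S x|)%N%:R.
pose N S := \sum_x L S x.
pose m := expect p E N.
have m_sum : m = \sum_x expect p E (L^~ x) by rewrite /m expect_sum.
have m_ge : #|G|%:R * q <= m.
  rewrite m_sum mulr_natl -sumr_const; apply: ler_sum => x _; exact: q_le.
have N2 : expect p E (fun S => N S ^+ 2) <= #|G|%:R * chi + m ^+ 2.
  have -> : expect p E (fun S => N S ^+ 2) =
      \sum_x \sum_y expect p E (fun S => L S x * L S y).
    rewrite (eq_bigr (fun x => expect p E (fun S => \sum_y L S x * L S y))) => [|x _]; last by rewrite expect_sum.
    rewrite -expect_sum; apply: eq_expect => S _.
    by rewrite expr2 big_distrlr.
  apply: (@le_trans _ _ (\sum_x \sum_y (expect p E (fun S => (y \in component S x)%:R) +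
     expect p E (L^~ x) * expect p E (L^~ y)))).
    by apply: ler_sum => x _; apply: ler_sum => y _; exact: expect_two_large.
  have -> : m ^+ 2 = \sum_x \sum_y expect p E (L^~ x) * expect p E (L^~ y).
    by rewrite m_sum expr2 big_distrlr.
  rewrite mulr_natl -sumr_const -big_split; apply: ler_sum => x _.
  rewrite big_split lerD2r -expect_sum; apply: le_trans (le_chi x).
  apply: le_expect => // S _.
  rewrite -sum1_card natr_sum [leRHS]big_mkcond; apply: ler_sum => y _.
  by case: (y \in component S x).
have : m ^+ 2 * P0 <= #|G|%:R * chi.
  apply: (@le_trans _ _ (expect p E (fun S => (N S - m) ^+ 2))).
    rewrite -expectZ; apply: le_expect => // S _.
    have [/forallP small|_] := boolP [forall x, (#|component S x| < k)%N]; last by rewrite mulr0 sqr_ge0.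
    rewrite /N big1 ?mulr1 ?sub0r ?sqrrN // => x _.
    by rewrite /L leqNgt small.
  rewrite (@eq_expect _ _ _ _ _ (fun S => N S ^+ 2 + ((- (2 * m)) * N S + m ^+ 2))).
    by rewrite !expectD expectZ expect_cst -/m; lra.
  by move=> S _; ring.
have G0' : 0 < #|G|%:R :> R by rewrite ltr0n.
move=> mP0; rewrite -(ler_pM2l G0'); apply: le_trans mP0.
have -> (c : R) : c * (c * q ^+ 2 * P0) = (c * q) ^+ 2 * P0 by ring.
rewrite ler_wpM2r //.
by apply: lerXn2r; rewrite ?nnegrE ?mulr_ge0 // (le_trans _ m_ge) ?mulr_ge0.
Qed.

End SecondMoment.

(** * Non-backtracking walks and excursions *)

Section Walks.
Variable G : sgraph.
Implicit Types (v w x y z a b : G) (l s : seq G) (S : {set {set G}}).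

(** With the endpoint, this is the state needed to prolong a non-backtracking walk; for empty [l] it
    is [z], the vertex visited before [x]. *)
Definition penultimate z x l := last z (belast x l).

Fixpoint nbpath z x l :=
  if l is y :: l' then [&& y != z, adj x y & nbpath x y l'] else true.

(* The continuations of a non-backtracking walk whose last step goes from [z]
   to [x]; with [z = x] the first step is unconstrained. *)
Fixpoint nbwalks (t : nat) z x : seq (seq G) :=
  if t is t'.+1 then
    [seq y :: l | y <- enum (nbhd x :\ z), l <- nbwalks t' x y]
  else [:: [::]].

Lemma mem_nbwalks t z x l :
  (l \in nbwalks t z x) = (size l == t) && nbpath z x l.
Proof.
elim: t z x l => [|t IHt] z x [|y l] //=.
- by apply/allpairsPdep => -[? [? []]].
- rewrite eqSS; apply/allpairsPdep/and4P => [[y' [l' []]]|[st yz xy nb]].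
    rewrite mem_enum !inE IHt => /andP[yz xy] /andP[st nb] [-> ->].
    by [].
  by exists y, l; rewrite mem_enum !inE yz xy IHt st.
Qed.

Lemma nbwalks_uniq t z x : uniq (nbwalks t z x).
Proof.
elim: t z x => //= t IHt z x; apply: allpairs_uniq_dep => //.
  exact: enum_uniq.
by move=> [y l] [y' l'] _ _ /= [-> ->].
Qed.

Lemma nbpath_path z x l : nbpath z x l -> path (@adj G) x l.
Proof. by elim: l z x => //= y l IHl z x /and3P[_ -> /IHl]. Qed.

Lemma penultimate_adj z x l :
  l != [::] -> path (@adj G) x l -> adj (last x l) (penultimate z x l).
Proof.
elim: l z x => // y [|y' l] IHl z x _ /andP[xy].
  by rewrite /penultimate /= adj_sym.
exact: (IHl x y).
Qed.

Lemma penultimate_cat z x l1 l2 :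
  penultimate z x (l1 ++ l2) = penultimate (penultimate z x l1) (last x l1) l2.
Proof. by rewrite /penultimate belast_cat last_cat. Qed.

(** This justifies the convention that [z = x] leaves the first step free. *)
Lemma nbhd_selfD1 x : nbhd x :\ x = nbhd x.
Proof.
by apply/setP => y; rewrite !inE andbC; have [->|_] := eqVneq; rewrite ?andbT // adj_irrefl.
Qed.

Section Sums.
Variables (V : nmodType).
Implicit Types F : seq G -> V.

Lemma big_nbwalks0 z x F : \sum_(l <- nbwalks 0 z x) F l = F [::].
Proof. by rewrite big_seq1. Qed.

Lemma big_nbwalksS t z x F :
  \sum_(l <- nbwalks t.+1 z x) F l =
    \sum_(y in nbhd x :\ z) \sum_(l <- nbwalks t x y) F (y :: l).
Proof. by rewrite big_allpairs_dep big_enum. Qed.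

Lemma big_nbwalksD i k z x F :
  \sum_(l <- nbwalks (i + k) z x) F l =
    \sum_(l1 <- nbwalks i z x)
      \sum_(l2 <- nbwalks k (penultimate z x l1) (last x l1)) F (l1 ++ l2).
Proof.
elim: i z x F => [|i IHi] z x F; first by rewrite big_nbwalks0.
rewrite addSn !big_nbwalksS; apply: eq_bigr => y _.
by rewrite (IHi x y (fun l => F (y :: l))).
Qed.

End Sums.

Fixpoint wedges x l : {set {set G}} :=
  if l is y :: l' then [set x; y] |: wedges y l' else set0.

Lemma wedges_cat x l1 l2 :
  wedges x (l1 ++ l2) = wedges x l1 :|: wedges (last x l1) l2.
Proof. by elim: l1 x => [|y l1 IHl] x /=; rewrite ?set0U // IHl setUA. Qed.

Lemma mem_wedges x l e z : e \in wedges x l -> z \in e -> z \in x :: l.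
Proof.
elim: l x => [|y l IHl] x /=; first by rewrite inE.
rewrite in_setU1 => /orP[/eqP->|eW ze]; first by rewrite !inE => /orP[]->; rewrite ?orbT.
by rewrite in_cons (IHl y) ?orbT.
Qed.

Lemma card_wedges x l : uniq (x :: l) -> #|wedges x l| = size l.
Proof.
elim: l x => [|y l IHl] x; first by rewrite cards0.
rewrite [uniq _]/= => /andP[xl ul] /=; rewrite cardsU1 IHl //.
by have [/mem_wedges/(_ (set21 x y))|//] := boolP (_ \in _); rewrite (negPf xl).
Qed.

Lemma wedges_edges x l : path (@adj G) x l -> wedges x l \subset edges G.
Proof.
elim: l x => [|y l IHl] x /=; first by rewrite sub0set.
move=> /andP[xy /IHl]; rewrite subUset sub1set => ->; rewrite andbT inE.
by apply/existsP; exists x; apply/existsP; exists y; rewrite xy /=.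
Qed.

Lemma last_component S x l : wedges x l \subset S -> last x l \in component S x.
Proof.
elim: l x => [|y l IHl] x /=; first by rewrite component_refl.
rewrite subUset sub1set => /andP[xyS /IHl].
rewrite (@component_eq _ S x y) //.
by apply: component_closed xyS; exact: component_refl.
Qed.

Lemma wedges_rev x l : wedges (last x l) (rev (belast x l)) = wedges x l.
Proof.
elim: l x => [|y l IHl] x //=.
have E : last (last y l) (rev (belast y l)) = y.
  by case: l {IHl} => //= y' l; rewrite rev_cons last_rcons.
by rewrite rev_cons -cats1 wedges_cat IHl E /= setU0 setUC [in LHS](setUC [set y]).
Qed.

Lemma rev_adj_path x l :
  path (@adj G) x l -> path (@adj G) (last x l) (rev (belast x l)).
Proof.
move=> pth; rewrite rev_path; apply: sub_path pth => u w.
by rewrite adj_sym.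
Qed.

Lemma wedges_penultimate z x l :
  l != [::] -> [set last x l; penultimate z x l] \in wedges x l.
Proof.
elim: l z x => // y [|y' l] IHl z x _.
  by rewrite /penultimate /= setUC !inE eqxx.
by rewrite [wedges x _]/= in_setU1; apply/orP; right; exact: (IHl x y).
Qed.

(** A simple path never reverses a step of its own, so only its first step could lead back to
    [z]. *)
Lemma nbpath_uniq z x l : path (@adj G) x l -> uniq (x :: l) ->
  [set x; z] \notin wedges x l -> nbpath z x l.
Proof.
elim: l z x => // y l IHl z x /= /andP[xy pth] /and3P[xyl yl ul].
rewrite in_setU1 negb_or => /andP[yz _]; rewrite xy /=; apply/andP; split.
  by apply: contra yz => /eqP->.
apply: IHl => //=; first by rewrite yl.
apply: contra xyl => /mem_wedges/(_ (set22 y x)); exact.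
Qed.

Lemma mem_wedges_interior x y s b e :
  e \in wedges x (rcons (y :: s) b) -> exists2 z, z \in y :: s & z \in e.
Proof.
elim: s x y => [|y' s IHs] x y.
  rewrite /= !inE orbF => /orP[]/eqP->; exists y; rewrite !inE ?eqxx ?orbT //.
rewrite [wedges _ _]/= in_setU1 => /orP[/eqP->|/IHs[z zs ze]].
  by exists y; rewrite !inE eqxx ?orbT.
by exists z; rewrite // in_cons zs orbT.
Qed.

(* Two distinct simple paths with the same endpoints: from the first vertex
   where they part, [l'] makes an excursion which returns to [l] at [b]; [s] is
   this excursion run backwards, so that it closes up the segment [l2]. *)
Lemma excursion v l l' :
  uniq (v :: l) -> uniq (v :: l') -> path (@adj G) v l' ->
  last v l = last v l' -> l <> l' ->
  exists l1 l2 l3 s,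
    let b := last v (l1 ++ l2) in
    [/\ l = l1 ++ l2 ++ l3, l2 != [::] & s != [::]] /\
    [/\ last b s = last v l1, uniq (b :: s), path (@adj G) b s, (size s <= size l')%N
      & wedges b s \subset wedges v l' /\ [disjoint wedges b s & wedges v l]].
Proof.
elim: l v l' => [|a m IHl] v [|a' m'] //.
- move=> _ /= /and3P[vm _ _] _ def_v; case/negP: vm.
  by rewrite def_v mem_last.
- move=> /= /andP[vm _] _ _ def_v; case/negP: vm.
  by rewrite -def_v mem_last.
(* A shared first step is stripped by induction. The excursion then found cannot use it, because the
   simple path [l'] does not revisit [v]. *)
have [<- {a'}|aa'] := eqVneq a a'.
  rewrite [uniq _]/= => /andP[vm um] /andP[vm' um'] /andP[va pth] lst nmm'.
  have nmm : m <> m' by move=> E; apply: nmm'; rewrite E.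
  have [l1 [l2 [l3 [s [[def_m l2n sn] [lst_s us ps ss [sW dsW]]]]]]] :=
    IHl _ _ um um' pth lst nmm.
  exists (a :: l1), l2, l3, s; split=> /=; first by split; rewrite // def_m.
  split => //; first exact: leqW.
  split; first by rewrite subsetU // sW orbT.
  rewrite disjoint_sym disjoints_subset subUset sub1set -disjoints_subset inE.
  rewrite [X in _ && X]disjoint_sym dsW andbT; apply: contra vm' => /(subsetP sW) /mem_wedges; apply.
  exact: set21.
set l := a :: m; set l' := a' :: m' => ul ul' pth lst _.
have has_l : has (mem l) l'.
  apply/hasP; exists (last v l'); first exact: (mem_last a' m').
  by rewrite -lst; exact: (mem_last a m).
(* The vertex [b] is the first one of [l'] that lies on [l]. *)
have [b [tau [rest [bl tau_l def_l']]]] : exists b tau rest,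
    [/\ b \in l, ~~ has (mem l) tau & l' = rcons tau b ++ rest].
  by case: (split_find has_l) => b tau rest bl tau_l; exists b, tau, rest.
have [l2 [l3 [def_l lst2 l2n]]] : exists l2 l3,
    [/\ l = l2 ++ l3, last v l2 = b & l2 != [::]].
  case/splitPr: bl => p1 p2; exists (rcons p1 b), p2.
  by rewrite cat_rcons last_rcons; split=> //; case: p1.
exists [::], l2, l3, (rev (belast v (rcons tau b))); cbv zeta.
rewrite !cat0s lst2; have lstb : last v (rcons tau b) = b by rewrite last_rcons.
have [ut vtau] : uniq (rcons tau b) /\ v \notin rcons tau b.
  move: ul'; rewrite def_l' [uniq _]/= mem_cat negb_or cat_uniq.
  by move=> /andP[/andP[-> _] /and3P[-> _ _]].
have pth_tau : path (@adj G) v (rcons tau b).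
  by move: pth; rewrite def_l' cat_path => /andP[].
split; first by split=> //; rewrite belast_rcons rev_cons; case: (rev tau).
split.
- by rewrite belast_rcons rev_cons last_rcons.
- rewrite belast_rcons /= mem_rev rev_uniq inE.
  move: ut vtau; rewrite rcons_uniq mem_rcons inE negb_or eq_sym.
  by move=> /andP[btau utau] /andP[bv vt]; rewrite /= vt utau (negPf btau) orbF bv.
- by rewrite -{1}lstb; exact: rev_adj_path.
- by rewrite size_rev size_belast def_l' size_cat leq_addr.
have W_tau : wedges b (rev (belast v (rcons tau b))) = wedges v (rcons tau b).
  by rewrite -[X in wedges X _]lstb wedges_rev.
rewrite W_tau; split; first by rewrite def_l' wedges_cat subsetUl.
have vl : v \notin l by case/andP: ul.
apply/pred0P => e /=; apply/negP => /andP[etau el].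
(* If [tau] is empty, the excursion is the single edge from [v] to [a'], whereas [l] leaves [v]
   towards [a] and never returns. Otherwise each of its edges has an end in [tau], off [l]. *)
case: tau => [|y tau] in tau_l def_l' etau {W_tau ut vtau pth_tau lstb}.
  move: etau; rewrite /= setU0 inE => /eqP def_e.
  have ba : b = a' by case: def_l' => ->.
  move: el; rewrite /l /= def_e in_setU1 ba => /orP[/eqP/set2_eq|/mem_wedges/(_ (set21 _ _))].
    by case=> -[E1 E2]; [rewrite E2 eqxx in aa'|rewrite /l E1 inE eqxx in vl].
  by rewrite (negPf vl).
have [z ztau ze] := mem_wedges_interior etau.
have := @mem_wedges v l e z el ze; rewrite inE => /orP[/eqP zv|zl].
  case/andP: ul' => /negP[]; rewrite def_l' -zv mem_cat mem_rcons.
  by rewrite in_cons ztau orbT.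
by case/hasP: tau_l; exists z.
Qed.

End Walks.

(** * Walk counts and the law of the non-backtracking walk *)

Lemma last_take (T : Type) (x : T) (s : seq T) (i : nat) :
  (i <= size s)%N -> last x (take i s) = nth x (x :: s) i.
Proof.
elim: s x i => [|y s IHs] x [|i] // il.
by rewrite [take _ _]/= [last _ _]/= IHs //; apply: set_nth_default.
Qed.

Lemma sum_eq_indicator (R : pzSemiRingType) (T : finType) (A : {set T}) (y : T) :
  \sum_(z in A) (z == y)%:R = (y \in A)%:R :> R.
Proof.
have [yA|yA] := boolP (y \in A).
  by rewrite (bigD1 y) //= eqxx big1 ?addr0 // => z /andP[_ /negPf->].
by rewrite big1 // => z zA; case: eqP => // zy; rewrite -zy zA in yA.
Qed.

Section WalkCounts.
Variables (R : realFieldType) (G : sgraph) (D : nat).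
Hypothesis regG : regular G D.+1.

Lemma card_nbhdD1 (z x : G) : adj x z -> #|nbhd x :\ z| = D.
Proof.
move=> xz; have zx : z \in nbhd x by rewrite inE.
by have := regG x; rewrite (cardsD1 z) zx => -[].
Qed.

Lemma size_nbwalks (t : nat) (z x : G) :
  adj x z -> size (nbwalks t z x) = (D ^ t)%N.
Proof.
elim: t z x => // t IHt z x xz; rewrite -sum1_size big_nbwalksS.
under eq_bigr => y /[!inE] /andP[_ xy].
  rewrite sum1_size IHt 1?adj_sym //.
over.
by rewrite sum_nat_const card_nbhdD1 // expnS.
Qed.

Lemma size_nbwalks_start (t : nat) (x : G) :
  size (nbwalks t.+1 x x) = (D.+1 * D ^ t)%N.
Proof.
rewrite -sum1_size big_nbwalksS nbhd_selfD1.
under eq_bigr => y /[!inE] xy.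
  rewrite sum1_size size_nbwalks 1?adj_sym //.
over.
by rewrite sum_nat_const regG.
Qed.

(** All non-backtracking walks of length [t.+1] from [v] are equally likely. The last edge is
    recorded because the next step depends on it. *)
Lemma nbwalks_edge_count (v : G) (t : nat) (x y : G) : (0 < D)%N ->
  \sum_(l <- nbwalks t.+1 v v) ((penultimate v v l == x) && (last v l == y))%:R
  = (D.+1 * D ^ t)%:R * nbrw_edge R v t x y.
Proof.
move=> D0.
have D0' : D%:R != 0 :> R by rewrite pnatr_eq0 -lt0n.
have D1' : D.+1%:R != 0 :> R by rewrite pnatr_eq0.
elim: t x y => [|t IHt] x y.
  rewrite big_nbwalksS nbhd_selfD1.
  under eq_bigr => y' _ do rewrite big_nbwalks0 /penultimate /=.
  rewrite /= /unif_mass regG muln1 (eq_sym v x).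
  have [xv|xv] := eqVneq x v => /=; last by rewrite mul0r mulr0 big1.
  by rewrite mul1r mulrCA mulfV // mulr1 sum_eq_indicator.
rewrite -[t.+2]addn1 big_nbwalksD [nbrw_edge _ _ _ _ _]/= mulr_sumr.
under [RHS]eq_bigr => w _.
  rewrite mulrA expnS mulnCA natrM -[X in X * _]mulrA -IHt mulr_sumr mulr_suml.
over.
rewrite exchange_big; apply: eq_big_seq => l; rewrite mem_nbwalks => /andP[/eqP sl nb].
have lxl : adj (last v l) (penultimate v v l).
  by apply: penultimate_adj (nbpath_path nb); case: (l) sl.
rewrite (bigD1 (penultimate v v l)) // eqxx [X in _ = _ + X]big1 ?addr0; last first.
  by move=> w wp; rewrite eq_sym (negPf wp) mulr0 mul0r.
rewrite big_nbwalksS.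
under eq_bigr => y' _ do rewrite big_nbwalks0 last_cat /= penultimate_cat /penultimate /=.
have [lx|lx] := eqVneq (last v l) x; last by rewrite mulr0 mul0r big1.
rewrite lx in lxl *.
rewrite /unif_mass card_nbhdD1 // mulr1 mulrA mulrC mulrA mulVf // mul1r.
by rewrite sum_eq_indicator.
Qed.

End WalkCounts.

Lemma nbwalks_end_count (R : realFieldType) (G : sgraph) (D : nat) (v : G) (t : nat) (y : G) :
  regular G D.+1 -> (0 < D)%N ->
  \sum_(l <- nbwalks t.+1 v v) (last v l == y)%:R
  = (D.+1 * D ^ t)%:R * nbrw_prob R v t.+1 y.
Proof.
move=> regG D0; rewrite [nbrw_prob _ _ _ _]/= mulr_sumr.
under [RHS]eq_bigr => x _ do rewrite -nbwalks_edge_count //.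
rewrite exchange_big; apply: eq_bigr => l _.
rewrite (bigD1 (penultimate v v l)) //= eqxx big1 ?addr0 //.
by move=> x /negPf; rewrite eq_sym => ->.
Qed.

(** * Invariance of return probabilities under automorphisms *)

Section Automorphism.
Variables (R : numFieldType) (G : sgraph) (s : {perm G}).
Hypothesis s_adj : forall u w : G, adj (s u) (s w) = adj u w.

Lemma nbhd_aut (x : G) : nbhd (s x) = s @: nbhd x.
Proof.
apply/setP => y; rewrite -[y](permKV s) (mem_imset _ _ perm_inj) !inE.
exact: s_adj.
Qed.

Lemma unif_mass_aut (A : {set G}) (y : G) :
  unif_mass R (s @: A) (s y) = unif_mass R A y.
Proof. by rewrite /unif_mass (mem_imset _ _ perm_inj) card_imset //; exact: perm_inj. Qed.

Lemma nbrw_edge_aut (v x y : G) (t : nat) :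
  nbrw_edge R (s v) t (s x) (s y) = nbrw_edge R v t x y.
Proof.
elim: t x y => [|t IHt] x y /=.
  by rewrite nbhd_aut unif_mass_aut (inj_eq perm_inj).
rewrite (reindex_inj (@perm_inj _ s)); apply: eq_bigr => w _.
rewrite IHt -[in RHS]unif_mass_aut; congr (_ * unif_mass _ _ _); apply/setP => z.
rewrite -[z](permKV s) (mem_imset _ _ perm_inj) in_setD1 (inj_eq perm_inj).
by rewrite nbhd_aut (mem_imset _ _ perm_inj) in_setD1.
Qed.

Lemma nbrw_prob_aut (v y : G) (t : nat) :
  nbrw_prob R (s v) t (s y) = nbrw_prob R v t y.
Proof.
case: t => [|t] /=; first by rewrite (inj_eq perm_inj).
by rewrite (reindex_inj (@perm_inj _ s)); apply: eq_bigr => w _; exact: nbrw_edge_aut.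
Qed.

End Automorphism.

Lemma nbrw_return_transitive (R : numFieldType) (G : sgraph) (v x : G) (t : nat) :
  vertex_transitive G -> nbrw_prob R x t x = nbrw_prob R v t v.
Proof. by move=> /(_ v x)[s [s_adj <-]]; exact: nbrw_prob_aut. Qed.

Lemma unif_mass_ge0 (R : numFieldType) (G : sgraph) (A : {set G}) (y : G) :
  0 <= unif_mass R A y.
Proof. by rewrite divr_ge0. Qed.

Lemma nbrw_prob_ge0 (R : numFieldType) (G : sgraph) (v y : G) (t : nat) :
  0 <= nbrw_prob R v t y.
Proof.
have edge_ge0 u x z : 0 <= nbrw_edge R v u x z.
  elim: u x z => [|u IHu] x z /=; first by rewrite mulr_ge0 ?unif_mass_ge0.
  by apply: sumr_ge0 => w _; rewrite mulr_ge0 ?unif_mass_ge0.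
by case: t => [|t] //=; apply: sumr_ge0.
Qed.

(** * Counting walks together with a return *)

Section Lollipops.
Variables (R : realFieldType) (G : sgraph) (D : nat).
Hypothesis regG : regular G D.+1.
Hypothesis D0 : (0 < D)%N.
Variable v : G.
Implicit Types (l s : seq G) (i k m t : nat).

Definition vertex_at l i := last v (take i l).

(* The non-backtracking walks of length [m] which prolong the first [k] steps
   of [l] and end at the vertex reached by [l] after [i] steps. *)
Definition returns m l i k : seq (seq G) :=
  [seq s <- nbwalks m (penultimate v v (take k l)) (vertex_at l k)
     | last (vertex_at l k) s == vertex_at l i].

Lemma size_returns m l i k : (size (returns m l i k))%:R =
  \sum_(s <- nbwalks m (penultimate v v (take k l)) (vertex_at l k))
     (last (vertex_at l k) s == vertex_at l i)%:R :> R.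
Proof. by rewrite size_filter -sum1_count natr_sum big_mkcond; apply: eq_bigr => s _; case: eqP. Qed.

(* A walk together with a return forms a lollipop: a stick of length [i], a
   closed walk of length [k + m] and a tail. *)
Lemma sum_size_returns i k m t (c : R) : (0 < k)%N ->
  (forall a : G, \sum_(l <- nbwalks (k + m) a a) (last a l == a)%:R <= c) ->
  \sum_(l <- nbwalks (i + (k + t)) v v) (size (returns m l i (i + k)))%:R
   <= (size (nbwalks i v v))%:R * c * D%:R ^+ t.
Proof.
move=> k0 le_c.
rewrite big_nbwalksD -[X in X%:R * _ * _]sum1_size natr_sum !mulr_suml.
rewrite big_seq [leRHS]big_seq; apply: ler_sum => l1; rewrite mem_nbwalks => /andP[/eqP s1 nb1].
rewrite mul1r; set a := last v l1; set z := penultimate v v l1.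
pose g l2 : R := \sum_(s <- nbwalks m (penultimate a a l2) (last a l2)) (last (last a l2) s == a)%:R.
have g0 l2 : 0 <= g l2 by apply: sumr_ge0.
rewrite big_nbwalksD.
apply: (@le_trans _ _ (\sum_(l2 <- nbwalks k z a) g l2 * D%:R ^+ t)).
  rewrite big_seq [leRHS]big_seq; apply: ler_sum => l2.
  rewrite mem_nbwalks => /andP[/eqP s2 nb2].
  have l2n : l2 != [::] by case: (l2) s2 k0 => // <-.
  (* Since [l2] is nonempty, the vertex before its end does not depend on what precedes [a]. *)
  have pen2 : penultimate a a l2 = penultimate z a l2 by case: (l2) l2n.
  have adj2 : adj (last a l2) (penultimate z a l2).
    by apply: penultimate_adj (nbpath_path nb2).
  have -> : D%:R ^+ t = (size (nbwalks t (penultimate z a l2) (last a l2)))%:R :> R.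
    by rewrite (size_nbwalks regG) // natrX.
  rewrite -sum1_size natr_sum mulr_sumr big_seq [leRHS]big_seq; apply: ler_sum => l3 _.
  rewrite mulr1 size_returns /vertex_at !catA (take_size_cat l3) ?size_cat ?s1 ?s2 //.
  by rewrite -catA take_size_cat // last_cat penultimate_cat -/a -/z /g pen2.
rewrite -mulr_suml ler_wpM2r ?exprn_ge0 //; apply: le_trans (le_c a).
rewrite big_nbwalksD.
case: k k0 {le_c} => // k _; rewrite !big_nbwalksS nbhd_selfD1.
rewrite big_mkcond [leRHS]big_mkcond /=; apply: ler_sum => y _.
(* The cycle differs from an arbitrary closed walk at [a] only in that its first step avoids [z];
   this restriction is dropped. *)
rewrite in_setD1 andbC; case: (y \in nbhd a) => //=.
case: (y != z); last by do 2!apply: sumr_ge0 => ? _.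
apply: ler_sum => l2 _; rewrite /g le_eqVlt; apply/orP; left; apply/eqP.
by apply: eq_bigr => s _; rewrite -last_cat.
Qed.

End Lollipops.

(** * Open simple walks without open excursions *)

Lemma ler_term_sum (R : numDomainType) (J : eqType) (r : seq J) (P : pred J)
    (F : J -> R) (j : J) :
  (forall i, P i -> 0 <= F i) -> j \in r -> P j -> F j <= \sum_(i <- r | P i) F i.
Proof.
move=> F0 jr Pj; rewrite (big_rem j) //= Pj lerDl; exact: sumr_ge0.
Qed.

Lemma ler_term_sumT (R : numDomainType) (J : finType) (P : pred J)
    (F : J -> R) (j : J) :
  (forall i, P i -> 0 <= F i) -> P j -> F j <= \sum_(i | P i) F i.
Proof. by move=> F0; exact: ler_term_sum F0 (mem_index_enum j). Qed.

Section GoodWalks.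
Variables (R : realFieldType) (G : sgraph) (v : G) (r : nat).
Implicit Types (l s : seq G) (S : {set {set G}}) (i k m t : nat).

(** Sharing no edge with [l] makes the excursion open independently of [l], at the cost of a factor
    [p] per step. *)
Definition open_excursion S l k s :=
  let b := vertex_at v l k in
  [&& uniq (b :: s), [disjoint wedges b s & wedges v l] & wedges b s \subset S].

Definition has_excursion S l :=
  [exists i : 'I_r, exists k : 'I_r, exists m : 'I_r.+1,
    (i + k.+1 <= size l)%N &&
    has (open_excursion S l (i + k.+1)) (returns v m l i (i + k.+1))].

Definition good_walk S l :=
  [&& uniq (v :: l), wedges v l \subset S & ~~ has_excursion S l].

(* Good walks are determined by their endpoint. *)
Lemma good_walks_le_component S :
  \sum_(1 <= t < r.+1) \sum_(l <- nbwalks t v v) (good_walk S l)%:R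
    <= #|component S v|%:R :> R.
Proof.
pose L := [seq l | t <- iota 1 r, l <- nbwalks t v v].
have memL l : l \in L -> (0 < size l <= r)%N /\ path (@adj G) v l.
  move=> /allpairsPdep[t [l' []]]; rewrite mem_iota mem_nbwalks => tr /andP[/eqP sl nb] ->.
  by rewrite sl (nbpath_path nb) ; split=> //; lia.
have Luniq : uniq L.
  apply: allpairs_uniq_dep; first exact: iota_uniq.
    by move=> t _; exact: nbwalks_uniq.
  move=> [t l] [t' l'] /allpairsPdep[t1 [l1 [_ l1w [-> ->]]]].
  move=> /allpairsPdep[t2 [l2 [_ l2w [-> ->]]]] /= l12; move: l1w l2w.
  by rewrite l12 !mem_nbwalks => /andP[/eqP<- _] /andP[/eqP<- _].
have -> : \sum_(1 <= t < r.+1) \sum_(l <- nbwalks t v v) (good_walk S l)%:R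
    = (size [seq l <- L | good_walk S l])%:R :> R.
  rewrite size_filter -sum1_count natr_sum [RHS]big_mkcond big_allpairs_dep /=.
  rewrite /index_iota subn1; apply: eq_bigr => t _; apply: eq_bigr => l _.
  by case: good_walk.
rewrite ler_nat -(size_map (last v)).
have inj : {in [seq l <- L | good_walk S l] &, injective (last v)}.
  move=> l l'; rewrite !mem_filter => /andP[/and3P[ul lS nex] lL].
  move=> /andP[/and3P[ul' l'S _] l'L] lst.
  apply/eqP/negPn/negP => /eqP ll'.
  have [/andP[_ slr] _] := memL _ lL; have [/andP[_ sl'r] pl'] := memL _ l'L.
  have [l1 [l2 [l3 [s [[def_l l2n sn] [lst_s us ps ss [sW dsW]]]]]]] :=
    excursion ul ul' pl' lst ll'.
  case/negP: nex.
  have l2_0 : (0 < size l2)%N by case: (l2) l2n.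
  have sl : size l = (size l1 + (size l2 + size l3))%N by rewrite def_l !size_cat.
  have slr' : (size l1 + (size l2 + size l3) <= r)%N by rewrite -sl.
  have ir : (size l1 < r)%N by move: l2_0 slr'; clear; lia.
  have kr : ((size l2).-1 < r)%N by move: l2_0 slr'; clear; lia.
  have mr : (size s < r.+1)%N by exact: leq_trans ss sl'r.
  apply/existsP; exists (Ordinal ir); apply/existsP; exists (Ordinal kr).
  apply/existsP; exists (Ordinal mr) => /=.
  rewrite prednK // sl addnA leq_addr /=.
  have tk1 : take (size l1) l = l1 by rewrite def_l take_size_cat.
  have tk2 : take (size l1 + size l2) l = l1 ++ l2.
    by rewrite def_l catA take_size_cat ?size_cat.
  apply/hasP; exists s; last first.
    by rewrite /open_excursion /vertex_at tk2 us dsW (subset_trans sW).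
  rewrite mem_filter /vertex_at tk1 tk2 lst_s eqxx mem_nbwalks eqxx /=.
  (* The excursion does not start back along the last edge of [l1 ++ l2], since that edge belongs to
     [l]. *)
  apply: nbpath_uniq => //; apply/negP => eW.
  have /pred0P/(_ [set last v (l1 ++ l2); penultimate v v (l1 ++ l2)]) := dsW.
  rewrite /= eW /= def_l catA wedges_cat inE wedges_penultimate //.
  by case: (l1) (l2) l2n => [|? ?] [].
rewrite cardE uniq_leq_size ?map_inj_in_uniq ?filter_uniq // => y /mapP[l].
rewrite mem_filter => /andP[/and3P[_ lS _] _] ->.
by rewrite mem_enum last_component.
Qed.

(** A bound for the mean number of open excursions given that [l] is open. The terms with [m = 0]
    count coincidences among the vertices of [l], so walks that are not simple are charged as
    well. *)
Definition lollipops (p : R) l : R :=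
  \sum_(i < r) \sum_(k < r | (i + k.+1 <= size l)%N) \sum_(m < r.+1)
    (size (returns v m l i (i + k.+1)))%:R * p ^+ m.

Lemma lollipops_not_uniq (p : R) l : 0 <= p -> (size l <= r)%N ->
  ~~ uniq (v :: l) -> 1 <= lollipops p l.
Proof.
move=> p0 slr /(uniqPn v)[i [j [ij jl eqij]]]; move: jl; rewrite ltnS => jl.
have jr : (j <= r)%N := leq_trans jl slr.
have ir : (i < r)%N by move: ij jr; clear; lia.
have kr : ((j - i).-1 < r)%N by move: ij jr; clear; lia.
have E : (i + (j - i).-1.+1)%N = j by move: ij; clear; lia.
apply: (le_trans _ (ler_term_sumT (j := Ordinal ir) _ _)) => //; last first.
  by move=> ? _; do 2!apply: sumr_ge0 => ? _; rewrite mulr_ge0 ?exprn_ge0.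
apply: (le_trans _ (ler_term_sumT (j := Ordinal kr) _ _)); first last.
- by rewrite /= E.
- by move=> ? _; apply: sumr_ge0 => ? _; rewrite mulr_ge0 ?exprn_ge0.
apply: (le_trans _ (ler_term_sumT (j := ord0) _ _)) => //; last first.
  by move=> ? _; rewrite mulr_ge0 ?exprn_ge0.
rewrite /= E expr0 mulr1 /returns /= /vertex_at !last_take //; last exact: leq_trans (ltnW ij) jl.
by rewrite -eqij eqxx.
Qed.

(** A union bound over excursions: for simple [l], the walk and an edge-disjoint excursion of [m]
    steps are both open with probability [p ^ (size l + m)]. For other [l] the left side is
    nonpositive. *)
Lemma expect_good_walk (p : R) l : 0 <= p <= 1 -> (size l <= r)%N ->
  path (@adj G) v l ->
  p ^+ size l * (1 - lollipops p l) <=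
    expect p (edges G) (fun S => (good_walk S l)%:R).
Proof.
move=> p01 slr pth; have [p0 p1] := andP p01.
have [ul|nul] := boolP (uniq (v :: l)); last first.
  apply: (@le_trans _ _ 0); last by apply: expect_ge0.
  by rewrite mulr_ge0_le0 ?exprn_ge0 // subr_le0 lollipops_not_uniq.
pose T S : R := \sum_(i < r) \sum_(k < r | (i + k.+1 <= size l)%N) \sum_(m < r.+1)
  \sum_(s <- returns v m l i (i + k.+1))
    ((wedges v l \subset S) && open_excursion S l (i + k.+1) s)%:R.
have T0 S : 0 <= T S by do 4!apply: sumr_ge0 => ? _.
apply: (@le_trans _ _ (expect p (edges G)
    (fun S => (wedges v l \subset S)%:R + (-1) * T S))); last first.
  apply: le_expect => // S _; rewrite mulN1r /good_walk ul /=.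
  have [lS|lS] := boolP (wedges v l \subset S); last by rewrite add0r oppr_le0.
  have [ex|_] /= := boolP (has_excursion S l); last by rewrite gerBl.
  rewrite subr_le0.
  move: ex => /existsP[i /existsP[k /existsP[m /andP[ikl /hasP[s sret sex]]]]].
  apply: (le_trans _ (ler_term_sumT (j := i) _ _)) => //; last first.
    by move=> ? _; do 3!apply: sumr_ge0 => ? _.
  apply: (le_trans _ (ler_term_sumT (j := k) _ _)) => //; last first.
    by move=> ? _; do 2!apply: sumr_ge0 => ? _.
  apply: (le_trans _ (ler_term_sumT (j := m) _ _)) => //; last first.
    by move=> ? _; apply: sumr_ge0 => ? _.
  by apply: (le_trans _ (ler_term_sum (j := s) _ _ _)) => //; rewrite lS sex.
rewrite expectD expectZ expect_subset ?wedges_edges // card_wedges //.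
rewrite mulN1r mulrBr mulr1 lerB // /T /lollipops expect_sum mulr_sumr.
apply: ler_sum => i _; rewrite expect_sum mulr_sumr.
apply: ler_sum => k ikl; rewrite expect_sum mulr_sumr.
apply: ler_sum => m _; rewrite expect_sum.
rewrite -(sum1_size (returns v m l i _)) natr_sum mulr_suml mulr_sumr.
rewrite big_seq [leRHS]big_seq; apply: ler_sum => s.
rewrite mem_filter mem_nbwalks => /and3P[_ /eqP sm nb].
rewrite mul1r; set b := vertex_at v l _ in nb *.
have [/andP[us dsl]|nok] := boolP (uniq (b :: s) && [disjoint wedges b s & wedges v l]);
    last first.
  rewrite (@eq_expect _ _ _ _ _ (fun=> 0)) ?expect_cst ?mulr_ge0 ?exprn_ge0 //.
  by move=> S _; rewrite /open_excursion -/b (andbA (uniq _)) (negPf nok) andbF.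
rewrite (@eq_expect _ _ _ _ _ (fun S => (wedges v l :|: wedges b s \subset S)%:R)).
  rewrite expect_subset; last by rewrite subUset !wedges_edges // (nbpath_path nb).
  rewrite cardsU disjoint_setI0 1?disjoint_sym // cards0 subn0 !card_wedges //.
  by rewrite sm exprD.
by move=> S _; rewrite /open_excursion -/b us dsl subUset.
Qed.

End GoodWalks.

(** * Lower bound for the mean component size *)

Lemma bernoulli_ge (R : realFieldType) (t : R) (n : nat) : 0 <= t <= 1 ->
  1 - n%:R * t <= (1 - t) ^+ n.
Proof.
move=> /andP[t0 t1]; elim: n => [|n IHn]; first by rewrite expr0; lra.
have h0 : 0 <= 1 - t by rewrite subr_ge0.
have n0 : 0 <= n%:R * t ^+ 2 :> R by rewrite mulr_ge0 ?exprn_ge0.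
rewrite exprS -natr1; have := ler_wpM2l h0 IHn; apply: le_trans; nra.
Qed.

(** A total length [l] splits as [k.+1 + m] in at most [l] ways; this is the source of the factor
    [t] in the hypothesis on return probabilities. *)
Lemma sum_shifted_le (R : numDomainType) (q : nat -> R) (r : nat) :
  (forall l, 0 <= q l) ->
  \sum_(k < r) \sum_(m < r.+1) q (k.+1 + m)%N
    <= \sum_(1 <= l < (2 * r).+1) l%:R * q l.
Proof.
move=> q0.
apply: (@le_trans _ _ (\sum_(k < r) \sum_(1 <= l < (2 * r).+1 | (k < l)%N) q l)).
  apply: ler_sum => k _.
  rewrite -(big_mkord xpredT (fun m => q (k.+1 + m)%N)).
  under eq_bigr => m _ do rewrite addnC.
  have -> : \sum_(0 <= m < r.+1) q (m + k.+1)%N = \sum_(k.+1 <= l < k.+1 + r.+1) q l.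
    by symmetry; rewrite -{1}[k.+1%N]add0n big_addn addKn.
  rewrite (@big_nat_widen _ _ _ _ _ (2 * r).+1); last by have := ltn_ord k; lia.
  rewrite (@big_nat_widenl _ _ _ k.+1 1) //.
  rewrite big_mkcond [leRHS]big_mkcond; apply: ler_sum => l _ /=.
  by case: (k < l)%N; rewrite ?andbT ?andbF //; case: ifP.
rewrite (exchange_big_dep xpredT) //=; apply: ler_sum => l _.
rewrite sumr_const -[leLHS]mulr_natl ler_wpM2r // ler_nat.
rewrite -[leqRHS](size_iota 0) cardE -(size_map val) uniq_leq_size //.
  by rewrite map_inj_uniq ?enum_uniq //; exact: val_inj.
by move=> _ /mapP[k + ->]; rewrite mem_enum mem_iota add0n.
Qed.

Section FirstMoment.
Variables (R : realFieldType) (G : sgraph) (D : nat).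
Hypothesis regG : regular G D.+1.
Hypothesis D2 : (2 <= D)%N.
Hypothesis transG : vertex_transitive G.
Variables (p eps : R) (v : G) (r : nat).
Hypothesis p0 : 0 <= p.
Hypothesis eps01 : 0 <= eps <= 1.
Hypothesis p_def : p * D%:R = 1 - eps.

Let q l := nbrw_prob R v l v.
Let D2R : 2 <= D%:R :> R. Proof. by rewrite ler_nat. Qed.
Let D0 : (0 < D)%N. Proof. exact: ltn_trans D2. Qed.
Let p01 : 0 <= p <= 1.
Proof. by rewrite p0 /=; have := D2R; move: p_def eps01; move: D%:R => y *; nra. Qed.

Let D1_le : D.+1%:R <= 3 / 2 * D%:R :> R.
Proof. by rewrite -natr1; have := D2R; lra. Qed.

Lemma size_nbwalks_le i : (size (nbwalks i v v))%:R <= 3 / 2 * D%:R ^+ i :> R.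
Proof.
case: i => [|i]; first by rewrite /= expr0; lra.
by rewrite (size_nbwalks_start regG) natrM natrX exprS mulrA ler_wpM2r ?exprn_ge0.
Qed.

Lemma size_nbwalks_ge t : D%:R ^+ t <= (size (nbwalks t v v))%:R :> R.
Proof.
case: t => [|t]; first by rewrite expr0.
by rewrite (size_nbwalks_start regG) natrM natrX exprS ler_wpM2r ?exprn_ge0 ?ler_nat.
Qed.

Lemma closed_walks_le l (a : G) : (0 < l)%N ->
  \sum_(s <- nbwalks l a a) (last a s == a)%:R <= 3 / 2 * D%:R ^+ l * q l.
Proof.
case: l => // l _; rewrite (@nbwalks_end_count _ _ D) //.
rewrite (@nbrw_return_transitive _ _ v a) // -/(q _) ler_wpM2r ?nbrw_prob_ge0 //.
by rewrite natrM natrX exprS mulrA ler_wpM2r ?exprn_ge0.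
Qed.

(* [9 / 4] bounds [(d / (d - 1)) ^ 2]: the first step of the stick and that of
   the closed walk each have [d] choices instead of [d - 1]. *)
Lemma sum_lollipops_le t : (t <= r)%N ->
  p ^+ t * \sum_(l <- nbwalks t v v) lollipops v r p l <=
    9 / 4 * r%:R * \sum_(1 <= l < (2 * r).+1) l%:R * q l.
Proof.
move=> tr; have q0 l : 0 <= q l by exact: nbrw_prob_ge0.
have [pge0 ple1] := andP p01.
have -> : \sum_(l <- nbwalks t v v) lollipops v r p l =
  \sum_(i < r) \sum_(k < r | (i + k.+1 <= t)%N) \sum_(m < r.+1)
    \sum_(l <- nbwalks t v v) (size (returns v m l i (i + k.+1)))%:R * p ^+ m.
  rewrite (eq_big_seq (fun l => \sum_(i < r) \sum_(k < r | (i + k.+1 <= t)%N)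
    \sum_(m < r.+1) (size (returns v m l i (i + k.+1)))%:R * p ^+ m)).
    rewrite exchange_big; apply: eq_bigr => i _.
    rewrite exchange_big; apply: eq_bigr => k _.
    by rewrite exchange_big.
  by move=> l; rewrite mem_nbwalks => /andP[/eqP <- _].
rewrite -mulrA mulrCA [r%:R * _]mulr_natl -[X in _ *+ X]card_ord -sumr_const.
rewrite mulr_sumr; apply: ler_sum => i _.
have c0 : 0 <= 9 / 4 :> R by lra.
rewrite [leRHS]mulrC; apply: (le_trans _ (ler_wpM2r c0 (sum_shifted_le r q0))).
rewrite mulr_sumr mulr_suml big_mkcond; apply: ler_sum => k _.
case: ifP => ikt; last by rewrite mulr_ge0 ?sumr_ge0 //; lra.
rewrite mulr_sumr mulr_suml; apply: ler_sum => m _.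
rewrite -mulr_suml mulrA.
set u := (t - (i + k.+1))%N.
have -> : \sum_(l <- nbwalks t v v) (size (returns v m l i (i + k.+1)))%:R =
  \sum_(l <- nbwalks (i + (k.+1 + u)) v v) (size (returns v m l i (i + k.+1)))%:R :> R.
  by congr (\sum_(l <- nbwalks _ _ _) _); rewrite /u addnA subnKC.
have cl a := @closed_walks_le (k.+1 + m) a isT.
have := sum_size_returns regG v i u (ltn0Sn k) cl.
set X := \sum_(l <- _) _ => leX.
have {}leX : X <= 9 / 4 * q (k.+1 + m)%N * (D%:R ^+ (t + m)).
  apply: le_trans leX _.
  have -> : (t + m = i + (k.+1 + m) + u)%N.
    by rewrite /u; move: ikt; clear; lia.
  rewrite (exprD _ (i + _)) (exprD _ i).
  have q1 := q0 (k.+1 + m)%N.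
  have Du : 0 <= 3 / 2 * (D%:R ^+ (k.+1 + m)) * q (k.+1 + m)%N * D%:R ^+ u.
    by rewrite !mulr_ge0 ?exprn_ge0 //; lra.
  rewrite -mulrA; apply: le_trans (ler_wpM2r Du (size_nbwalks_le i)) _.
  by rewrite le_eqVlt; apply/orP; left; apply/eqP; field.
have pt0 : 0 <= p ^+ (t + m) by exact: exprn_ge0.
apply: (@le_trans _ _ (p ^+ (t + m) * X)); first by rewrite exprD mulrAC.
apply: le_trans (ler_wpM2l pt0 leX) _.
(* The powers of [p] and [D] combine to [(1 - eps) ^ (t + m) <= 1]. *)
rewrite mulrCA -exprMn p_def [leRHS]mulrC; have [e0 e1] := andP eps01.
apply: ler_piMr; first by rewrite mulr_ge0.
by apply: exprn_ile1; lra.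
Qed.

(** For each length [t <= r] there are at least [D ^ t] walks, so on average at least
    [(1 - eps) ^ t >= 1 - r eps] open ones before the lollipops are subtracted. *)
Theorem expect_component_lower :
  r%:R * (1 - r%:R * eps) -
    9 / 4 * r%:R ^+ 2 * \sum_(1 <= l < (2 * r).+1) l%:R * q l
  <= expect p (edges G) (fun S => #|component S v|%:R).
Proof.
have [e0 e1] := andP eps01.
apply: (@le_trans _ _ (expect p (edges G) (fun S =>
   \sum_(1 <= t < r.+1) \sum_(l <- nbwalks t v v) (good_walk v r S l)%:R))); last first.
  by apply: le_expect => // S _; exact: good_walks_le_component.
set Q := \sum_(1 <= l < _) _.
rewrite expect_sum.
have -> : r%:R * (1 - r%:R * eps) - 9 / 4 * r%:R ^+ 2 * Q =
    \sum_(1 <= t < r.+1) ((1 - r%:R * eps) - 9 / 4 * r%:R * Q).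
  by rewrite sumr_const_nat subn1 -mulr_natl; ring.
rewrite big_nat_cond [leRHS]big_nat_cond; apply: ler_sum => t; rewrite andbT ltnS => /andP[t0 tr].
rewrite expect_sum.
apply: (@le_trans _ _ (\sum_(l <- nbwalks t v v) p ^+ t * (1 - lollipops v r p l))); last first.
  rewrite big_seq [leRHS]big_seq; apply: ler_sum => l.
  rewrite mem_nbwalks => /andP[/eqP sl nb]; rewrite -{1}sl.
  by apply: expect_good_walk; rewrite ?sl // (nbpath_path nb).
rewrite -mulr_sumr big_split /= sumrN mulrDr mulrN lerB ?sum_lollipops_le //.
have -> : \sum_(l <- nbwalks t v v) 1 = (size (nbwalks t v v))%:R :> R.
  by rewrite -sum1_size natr_sum.
apply: (@le_trans _ _ ((1 - eps) ^+ t)).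
  apply: le_trans (bernoulli_ge t eps01).
  by rewrite lerB // ler_wpM2r // ler_nat.
by rewrite -p_def exprMn ler_wpM2l ?exprn_ge0 ?size_nbwalks_ge.
Qed.

End FirstMoment.

(** * Tails of the largest component *)

Lemma perc_probE (R : realFieldType) (G : sgraph) (p : R) (P : pred {set {set G}}) :
  perc_prob p P = expect p (edges G) (fun S => (P S)%:R).
Proof.
rewrite /perc_prob /expect big_mkcondr; apply: eq_bigr => S _.
by case: (P S); rewrite ?mulr1 ?mulr0.
Qed.

Section LargestComponent.
Variable G : sgraph.
Implicit Types (S : {set {set G}}) (k : nat).

Lemma leq_largest S k x : (k <= #|component S x|)%N -> (k <= largest_component_size S)%N.
Proof. by move=> /leq_trans; apply; rewrite /largest_component_size (leq_bigmax x). Qed.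

Lemma largest_exists S k : (0 < k)%N -> (k <= largest_component_size S)%N ->
  exists x, (k <= #|component S x|)%N.
Proof.
move=> k0 kl; apply/existsP; apply: contraLR kl => /existsPn small.
rewrite -ltnNge -(prednK k0) ltnS; apply/bigmax_leqP => x _.
by rewrite -ltnS prednK // ltnNge small.
Qed.

Lemma largest_le_card S : (largest_component_size S <= #|G|)%N.
Proof. by apply/bigmax_leqP => x _; exact: max_card. Qed.

Lemma largest_gt0 S (x : G) : (0 < largest_component_size S)%N.
Proof.
apply: (@leq_largest _ _ x); rewrite card_gt0; apply/set0Pn; exists x.
exact: component_refl.
Qed.

Lemma subset_largest S S' : S \subset S' ->
  (largest_component_size S <= largest_component_size S')%N.
Proof.
move=> SS'; apply/bigmax_leqP => x _; apply: (@leq_largest _ _ x).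
by rewrite subset_leq_card // subset_component.
Qed.

End LargestComponent.

Section Tails.
Variables (R : realFieldType) (G : sgraph) (D : nat).
Hypothesis regG : regular G D.+1.
Hypothesis D2 : (2 <= D)%N.

Let D2R : 2 <= D%:R :> R. Proof. by rewrite ler_nat. Qed.

(** For [j >= k] one has [j t >= 1], hence [(1 - t) ^ j <= 1 / 2]: the indicator is at most twice
    the generating-function term. *)
Lemma component_tail_le (p eta : R) (k : nat) (x : G) :
  0 <= p <= 1 -> 0 < eta <= 1 -> p * D%:R <= 1 + eta / 16 ->
  16 <= k%:R * eta ^+ 2 ->
  expect p (edges G) (fun S => (k <= #|component S x|)%N%:R) <= 4 * eta.
Proof.
move=> p01 eta01 pD kle; have := expect_component_genfun regG D2 x p01 eta01 pD.
have [e0 e1] := andP eta01; set t := eta ^+ 2 / 16.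
have t0 : 0 <= t by rewrite divr_ge0 ?exprn_ge0 // ltW.
have t1 : t <= 1 by rewrite /t expr2; nra.
move=> gen; apply: (@le_trans _ _ (2 * expect p (edges G) (fun S => 1 - (1 - t) ^+ #|component S x|))); last by lra.
rewrite -expectZ; apply: le_expect => // S _.
have t01 : 0 <= t <= 1 by rewrite t0.
have powle j := @bernoulli_inv R t j t01.
have pow1 j : (1 - t) ^+ j <= 1 by rewrite exprn_ile1 //; lra.
case: leqP => [kC|_] /=; last by rewrite mulr_ge0 // subr_ge0.
have jt : 1 <= #|component S x|%:R * t.
  apply: (@le_trans _ _ (k%:R * t)); last by rewrite ler_wpM2r ?ler_nat.
  by rewrite /t mulrA; lra.
have : (1 - t) ^+ #|component S x| <= 2^-1.
  by apply: le_trans (powle _) _; rewrite lef_pV2 ?posrE //; lra.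
by move: (_ ^+ _) => w; lra.
Qed.

Lemma largest_tail_le (p eta : R) (k : nat) :
  0 <= p <= 1 -> 0 < eta <= 1 -> p * D%:R <= 1 + eta / 16 ->
  (0 < k)%N -> 16 <= k%:R * eta ^+ 2 ->
  k%:R * expect p (edges G) (fun S => (k <= largest_component_size S)%N%:R)
    <= #|G|%:R * (4 * eta).
Proof.
move=> p01 eta01 pD k0 kle; rewrite -expectZ.
apply: (@le_trans _ _ (expect p (edges G) (fun S => \sum_x (k <= #|component S x|)%N%:R))).
  apply: le_expect => // S _; case: (leqP k _) => [kl|_]; last first.
    by rewrite mulr0 sumr_ge0.
  have [x kx] := largest_exists k0 kl.
  rewrite mulr1 -natr_sum ler_nat; apply: (leq_trans kx).
  rewrite -sum1_card big_mkcond; apply: leq_sum => y _.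
  by case: ifP => // yx; rewrite (component_eq yx) kx.
rewrite expect_sum mulr_natl -sumr_const; apply: ler_sum => x _.
exact: component_tail_le.
Qed.

Section SubcriticalTail.
Variables (p eps c : R).
Hypothesis p0 : 0 <= p.
Hypothesis eps0 : 0 < eps.
Hypothesis c_ge : 2048 <= c.
Hypothesis ceps : c * eps <= 1.
Hypothesis p_def : p * D%:R = 1 - eps.

Let eps_le : 100 * eps <= 1.
Proof.
apply: le_trans ceps; rewrite ler_pM2r //; apply: le_trans c_ge.
by rewrite ler_nat.
Qed.

Let p01 : 0 <= p <= 1.
Proof.
by rewrite p0 /=; have := ler_wpM2l p0 D2R; rewrite p_def; move: eps0 p0; lra.
Qed.

Let pD1 : D.+1%:R * p <= 3 / 2.
Proof.
have := ler_wpM2l p0 D2R; rewrite -(natr1 D) mulrDl mul1r (mulrC _ p) p_def.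
by move: eps0; lra.
Qed.

Lemma subcritical_mean_le (x : G) :
  expect p (edges G) (fun S => #|component S x|%:R) <= 3 / eps.
Proof.
apply: le_trans (expect_component_card regG D2 p0 eps0 p_def x) _.
rewrite mulrA ler_pdivlMr // mulrDl divfK ?gt_eqF //.
by move: eps0 eps_le pD1; lra.
Qed.

Lemma subcritical_second_moment_le (x : G) :
  expect p (edges G) (fun S => #|component S x|%:R ^+ 2) <= 11 / eps ^+ 3.
Proof.
apply: le_trans (expect_component_card_sqr regG D2 p0 eps0 p_def x) _.
rewrite !mulrA; have : 0 <= D.+1%:R * p by rewrite mulr_ge0.
move: (D.+1%:R * p) pD1 => y y1 y0.
have -> : (1 + y / eps) ^+ 2 + y / eps ^+ 3 = ((eps + y) ^+ 2 * eps + y) / eps ^+ 3.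
  by field; rewrite gt_eqF.
rewrite ler_wpM2r ?invr_ge0 ?exprn_ge0 ?ltW //.
have : (eps + y) ^+ 2 <= 9.
  have -> : 9 = 3 ^+ 2 :> R by ring.
  by move: eps0 eps_le => *; apply: lerXn2r; rewrite ?nnegrE; lra.
by move: (_ ^+ 2) eps0 eps_le => w *; nra.
Qed.

(* Below the scale [eps ^- 2] of the typical large component, the truncated
   mean is at most half of the mean; Cauchy-Schwarz converts the rest of the
   mean into probability. *)
Lemma subcritical_tail_ge (k : nat) (x : G) :
  k%:R * (c * eps) ^+ 2 <= 16 ->
  (16 * eps)^-1 <= expect p (edges G) (fun S => #|component S x|%:R) ->
  eps / (88 * 128) <= expect p (edges G) (fun S => (k <= #|component S x|)%N%:R).
Proof.
move=> kle mean_ge; set P := expect p _ _; move: (eps0) (eps_le) => he0 he1.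
(* The value of [th] makes the second-moment term [th * (11 / eps ^ 3)] equal to [1 / (64 eps)]. *)
pose eta := c * eps; pose t := eta ^+ 2 / 16; pose th := eps ^+ 2 / 704.
rewrite -/eta in kle.
have c0 : 0 < c by apply: lt_le_trans c_ge; rewrite ltr0n.
have e0 : 0 < eta by rewrite mulr_gt0.
have t0 : 0 < t by rewrite divr_gt0 ?exprn_gt0.
have t1 : t <= 1.
  have : eta ^+ 2 <= 1 by rewrite exprn_ile1 // ltW.
  by rewrite /t; lra.
have th0 : 0 < th by rewrite divr_gt0 ?exprn_gt0.
have gen : expect p (edges G) (fun S => 1 - (1 - t) ^+ #|component S x|) <= 2 * eta.
  by apply: (expect_component_genfun regG D2 x p01); rewrite ?e0 // p_def; lra.
have sqr_le := subcritical_second_moment_le x.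
(* For [j >= k] this is [j <= th j ^ 2 + 1 / (4 th)], a pointwise form of Cauchy-Schwarz. For
   [j < k] one has [j t <= 1], hence [1 - (1 - t) ^ j >= j t / 2]. *)
have pw (j : nat) : j%:R <= 2 / t * (1 - (1 - t) ^+ j) + th * j%:R ^+ 2
    + (4 * th)^-1 * (k <= j)%N%:R.
  have j0 : 0 <= j%:R :> R by [].
  have t01 : 0 <= t <= 1 by rewrite (ltW t0).
  have pow := @bernoulli_inv R t j t01.
  have g0 : 0 <= 1 - (1 - t) ^+ j by rewrite subr_ge0 exprn_ile1 //; lra.
  have [kj|jk] /= := leqP k j.
    have : 0 <= th * (j%:R - (2 * th)^-1) ^+ 2 by rewrite mulr_ge0 ?sqr_ge0 // ltW.
    have -> : th * (j%:R - (2 * th)^-1) ^+ 2 = th * j%:R ^+ 2 + (4 * th)^-1 - j%:R.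
      by field; rewrite gt_eqF.
    have : 0 <= 2 / t * (1 - (1 - t) ^+ j) by rewrite mulr_ge0 // divr_ge0 // ltW.
    by rewrite mulr1; lra.
  have thj : 0 <= th * j%:R ^+ 2 by rewrite (mulr_ge0 (ltW th0)) // exprn_ge0.
  rewrite mulr0 addr0; apply: ler_wpDr => //.
  have jt1 : j%:R * t <= 1.
    apply: (@le_trans _ _ (k%:R * t)); first by rewrite ler_pM2r // ler_nat ltnW.
    by rewrite /t mulrA; lra.
  rewrite mulrAC ler_pdivlMr //; set y := j%:R * t in jt1 pow *.
  have y0 : 0 <= y by rewrite mulr_ge0 // ltW.
  have : (1 + y)^-1 <= 1 - y / 2.
    by rewrite -[leLHS]mul1r ler_pdivrMr; nra.
  by lra.
have : expect p (edges G) (fun S => #|component S x|%:R) <=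
   2 / t * (2 * eta) + th * (11 / eps ^+ 3) + (4 * th)^-1 * P.
  apply: (@le_trans _ _ (expect p (edges G) (fun S =>
     2 / t * (1 - (1 - t) ^+ #|component S x|) + th * #|component S x|%:R ^+ 2
     + (4 * th)^-1 * (k <= #|component S x|)%N%:R))).
    by apply: le_expect => // S _; exact: pw.
  rewrite !expectD !expectZ lerD2r lerD // ler_wpM2l // ?ltW //.
  by rewrite divr_gt0.
(* The condition [c >= 2048] is exactly [64 / c <= 1 / 32]. The three losses leave
   [1 / 16 - 1 / 32 - 1 / 64 = 1 / 64], and [64 * 176 = 88 * 128]. *)
have t_le : 2 / t * (2 * eta) <= (32 * eps)^-1.
  have -> : 2 / t * (2 * eta) = 64 / c / eps by rewrite /t /eta; field; rewrite !gt_eqF.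
  rewrite invfM ler_pM2r ?invr_gt0 // ler_pdivrMr // mulrC ler_pdivlMr //.
  by apply: le_trans c_ge; rewrite -natrM ler_nat.
move: (_ / t * _) t_le => w w_le.
have -> : th * (11 / eps ^+ 3) = (64 * eps)^-1 by rewrite /th; field; rewrite gt_eqF.
have -> : (4 * th)^-1 = 176 / eps ^+ 2 by rewrite /th; field; rewrite gt_eqF.
move=> /(le_trans mean_ge).
move=> {}mean_ge; have {}mean_ge : (16 * eps)^-1 <= (32 * eps)^-1 + (64 * eps)^-1 + 176 / eps ^+ 2 * P.
  by apply: le_trans mean_ge _; rewrite !lerD2r.
move: mean_ge; rewrite -(ler_pM2r (exprn_gt0 2 eps0)).
have -> : (16 * eps)^-1 * eps ^+ 2 = eps / 16 by field; rewrite gt_eqF.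
have -> : ((32 * eps)^-1 + (64 * eps)^-1 + 176 / eps ^+ 2 * P) * eps ^+ 2
   = eps / 32 + eps / 64 + 176 * P by field; rewrite gt_eqF.
by lra.
Qed.

Lemma subcritical_largest_lt (k : nat) : (0 < #|G|)%N ->
  k%:R * (c * eps) ^+ 2 <= 16 ->
  (forall x : G, (16 * eps)^-1 <=
     expect p (edges G) (fun S => #|component S x|%:R)) ->
  #|G|%:R * eps ^+ 3 *
    expect p (edges G) (fun S => (largest_component_size S < k)%N%:R)
    <= 3 * (88 * 128) ^+ 2.
Proof.
move=> G0 kle mean_ge.
have q0 : 0 <= eps / (88 * 128) by rewrite divr_ge0 ?mulr_ge0 // ltW.
have := second_moment_method p01 G0 q0
  (fun x => subcritical_tail_ge kle (mean_ge x)) subcritical_mean_le.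
set P := expect p _ _; set P' := expect p _ _ => h.
have P'P : P' <= P.
  apply: le_expect => // S _; apply: ler_bool => lk; apply/forallP => x.
  by rewrite ltnNge; apply: contraL lk => /leq_largest; rewrite -leqNgt.
have : #|G|%:R * eps ^+ 3 * P' <= #|G|%:R * eps ^+ 3 * P.
  by rewrite ler_wpM2l // mulr_ge0 // exprn_ge0 // ltW.
move=> /le_trans; apply.
have b0 : 0 < 88 * 128 :> R by rewrite mulr_gt0.
move: (88 * 128) b0 h => b b0 h.
rewrite -ler_pdivrMr ?exprn_gt0 //.
have -> : #|G|%:R * eps ^+ 3 * P / b ^+ 2 = #|G|%:R * (eps / b) ^+ 2 * P * eps.
  by field; rewrite gt_eqF.
by rewrite -ler_pdivlMr.
Qed.

End SubcriticalTail.

End Tails.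

(* The scale [n ^ (1 / 3)] and the choice of constants *)
From mathcomp Require Import all_classical all_reals all_analysis.
Import Order.TTheory GRing.Theory Num.Theory.
Import numFieldNormedType.Exports.
Local Open Scope classical_set_scope.
Local Open Scope ring_scope.

Lemma subcritical_mean_ge (R : realType) (G : sgraph) (D : nat) (p eps a K : R) (v : G) :
  regular G D.+1 -> (2 <= D)%N -> vertex_transitive G ->
  0 <= p -> p * D%:R = 1 - eps -> 0 < eps -> 4 * eps <= 1 ->
  1 <= a * eps -> 5 * K <= a * eps -> 0 <= K ->
  a * \sum_(1 <= t < (Num.truncn a).+1) t%:R * nbrw_prob R v t v <= K ->
  (16 * eps)^-1 <= expect p (edges G) (fun S => #|component S v|%:R).
Proof.
move=> regG D2 transG p0 p_def e0 e1 ae Kae K0 sumK.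
have a0 : 0 < a by rewrite -(pmulr_lgt0 _ e0); lra.
(* With this [r] the loss [r eps] is at most [1 / 2], and [2 r <= 1 / eps <= a] keeps the closed
   walks within the range of the hypothesis. *)
set r := Num.truncn (2 * eps)^-1.
have i0 : 0 <= (2 * eps)^-1 by rewrite invr_ge0 mulr_ge0 // ltW.
have /andP[r_le r_gt] := truncn_itv i0.
rewrite -/r in r_le r_gt.
have re : r%:R * (2 * eps) <= 1 by rewrite -ler_pdivlMr ?div1r // mulr_gt0.
have re' : 1 < (r%:R + 1) * (2 * eps).
  by rewrite -ltr_pdivrMr ?div1r ?natr1 // mulr_gt0.
have r0 : 0 <= r%:R :> R by [].
have e01 : 0 <= eps <= 1 by lra.
have := expect_component_lower regG D2 transG v r p0 e01 p_def.
set Q := \sum_(1 <= l < _) _; apply: le_trans.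
have q0 (l : nat) : 0 <= l%:R * nbrw_prob R v l v by rewrite mulr_ge0 // nbrw_prob_ge0.
have QK : a * Q <= K.
  apply: le_trans sumK; rewrite ler_pM2l //.
  have r2a : (2 * r <= Num.truncn a)%N.
    by rewrite truncn_ge_nat ?(ltW a0) // natrM -(ler_pM2r e0); lra.
  by rewrite [leRHS](@big_cat_nat _ _ _ (2 * r).+1) //= lerDl sumr_ge0.
have Q0 : 0 <= Q by exact: sumr_ge0.
(* From [r <= 1 / (2 eps)] and [5 K <= a eps] follows [r Q <= 1 / 10], so the lollipops cost at most
   [r / 4]. *)
have rQ : 9 * (r%:R * Q) <= 1.
  have h1 : r%:R * (a * Q) <= r%:R * K by rewrite ler_wpM2l.
  have h2 : r%:R * (a * Q) * eps <= r%:R * K * eps by rewrite ler_wpM2r // ltW.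
  have h3 : 0 <= (a * eps - 1) * (r%:R * Q) by rewrite !mulr_ge0 //; lra.
  have h4 : r%:R * K * (2 * eps) <= K by nra.
  have h5 : (r%:R * Q) * (a * eps) <= (a * eps) / 10 by lra.
  have : r%:R * Q <= 1 / 10 by nra.
  by lra.
rewrite -(ler_pM2r e0).
have -> : (16 * eps)^-1 * eps = 1 / 16 by field; rewrite gt_eqF.
have h6 : 9 * (r%:R ^+ 2 * Q) <= r%:R.
  have -> : 9 * (r%:R ^+ 2 * Q) = r%:R * (9 * (r%:R * Q)) by ring.
  by rewrite ler_piMr.
apply: (@le_trans _ _ (r%:R / 4 * eps)); first by nra.
by rewrite ler_pM2r //; nra.
Qed.

Lemma largest_lower_tail (R : realType) (G : sgraph) (D : nat) (p a M K c : R) (v : G) :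
  regular G D.+1 -> (2 <= D)%N -> vertex_transitive G -> #|G|%:R = a ^+ 3 ->
  p <= 1 -> 1 - M / a <= p * D%:R ->
  1 <= M -> 5 * K <= M -> 0 <= K -> 2048 <= c -> c * M <= a ->
  a * \sum_(1 <= t < (Num.truncn a).+1) t%:R * nbrw_prob R v t v <= K ->
  expect p (edges G) (fun S =>
    ((largest_component_size S)%:R < 8 * a ^+ 2 / (c * M) ^+ 2)%R%:R)
    <= 3 * (88 * 128) ^+ 2 / M ^+ 3.
Proof.
move=> regG D2 transG cardG p1 pD M1 KM K0 c_ge Ma sumK.
have M0 : 0 < M by exact: lt_le_trans ltr01 M1.
have c0 : 0 < c by apply: lt_le_trans c_ge; rewrite ltr0n.
have c4 : 4 <= c by apply: le_trans c_ge; rewrite ler_nat.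
have a0 : 0 < a by apply: lt_le_trans Ma; rewrite mulr_gt0.
have D0 : 0 < D%:R :> R by rewrite ltr0n (ltn_trans _ D2).
pose eps := M / a; pose p' := (1 - eps) / D%:R.
have e0 : 0 < eps by rewrite divr_gt0.
have e1 : c * eps <= 1 by rewrite /eps mulrA ler_pdivrMr // mul1r.
have ae : a * eps = M by rewrite /eps mulrC divfK ?gt_eqF.
have p'D : p' * D%:R = 1 - eps by rewrite divfK ?gt_eqF.
have e4 : 4 * eps <= 1 by apply: le_trans e1; rewrite ler_pM2r.
have p'0 : 0 <= p' by apply: divr_ge0; [move: e4 e0; lra|exact: ltW].
have p'p : p' <= p by rewrite /p' ler_pdivrMr; [exact: pD|exact: D0].
have ce2 : 0 < (c * eps) ^+ 2 by apply: exprn_gt0; exact: mulr_gt0 c0 e0.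
pose X := 16 / (c * eps) ^+ 2; pose k := Num.truncn X.
have X0 : 0 <= X by apply: divr_ge0; rewrite ?ler0n ?(ltW ce2).
have /andP[kX Xk] := truncn_itv X0.
have kle : k%:R * (c * eps) ^+ 2 <= 16.
  by rewrite -ler_pdivlMr; [exact: kX|exact: ce2].
have Xa : 8 * a ^+ 2 / (c * M) ^+ 2 = X / 2.
  by rewrite /X /eps; field; rewrite !gt_eqF.
have p01 : 0 <= p <= 1 by lra.
have p'1 : p' <= 1 by exact: le_trans p'p p1.
apply: (@le_trans _ _ (expect p (edges G) (fun S => (largest_component_size S < k)%N%:R))).
  apply: le_expect => // S _; apply: ler_bool; rewrite Xa => Lsmall.
  (* Rounding: [2 L < X < k + 1] gives [2 L <= k], and then [L < k] because [L >= 1]. *)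
  have L1 := largest_gt0 S v; rewrite ltnNge; apply/negP => kL.
  have : (2 * largest_component_size S < k.+1)%N.
    by rewrite -(ltr_nat R) natrM; apply: le_lt_trans Xk; lra.
  by move: L1 kL; clear; lia.
(* A small largest component is a decreasing event, so lowering [p] to [p'] makes it likelier. *)
apply: (@le_trans _ _ (expect p' (edges G) (fun S => (largest_component_size S < k)%N%:R))).
  have E q : expect q (edges G) (fun S => (largest_component_size S < k)%N%:R) =
      1 - expect q (edges G) (fun S => (k <= largest_component_size S)%N%:R).
    rewrite -{2}(expect_cst q (edges G) 1) -expectN -expectD; apply: eq_expect => S _.
    by rewrite ltnNge; case: (k <= _)%N; rewrite ?subrr ?subr0.
  rewrite !E lerB //; apply: le_expect_param => // S S' SS'.
  by apply: ler_bool => /leq_trans; apply; exact: subset_largest.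
have G0 : (0 < #|G|)%N by apply/card_gt0P; exists v.
rewrite ler_pdivlMr ?exprn_gt0 // mulrC.
have -> : M ^+ 3 = #|G|%:R * eps ^+ 3 by rewrite cardG -ae exprMn.
apply: (subcritical_largest_lt regG D2 p'0 e0 c_ge e1 p'D G0 kle) => x.
apply: (@subcritical_mean_ge _ _ D _ _ a K) => //; rewrite ?ae //.
under eq_bigr => t _ do rewrite (@nbrw_return_transitive _ _ v x) //.
exact: sumK.
Qed.

Lemma largest_upper_tail (R : realType) (G : sgraph) (D : nat) (p a H A : R) :
  regular G D.+1 -> (2 <= D)%N -> #|G|%:R = a ^+ 3 ->
  0 <= p <= 1 -> p * D%:R <= 1 + H / a / 16 ->
  16 <= H -> H <= a -> 1 <= A ->
  expect p (edges G) (fun S =>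
    (A * a ^+ 2 < (largest_component_size S)%:R)%R%:R) <= 4 * H / A.
Proof.
move=> regG D2 cardG p01 pD H16 Ha A1.
have a0 : 0 < a by lra.
have A0 : 0 < A by lra.
have eta01 : 0 < H / a <= 1 by rewrite divr_gt0 ?ler_pdivrMr ?mul1r //; lra.
have a20 : 0 < a ^+ 2 by rewrite exprn_gt0.
have Aa0 : 0 <= A * a ^+ 2 by rewrite mulr_ge0 // ltW.
have /andP[_] := truncn_itv Aa0; set k := (Num.truncn _).+1 => kgt.
have k16 : 16 <= k%:R * (H / a) ^+ 2.
  apply: (@le_trans _ _ (A * a ^+ 2 * (H / a) ^+ 2)).
    have -> : A * a ^+ 2 * (H / a) ^+ 2 = A * H ^+ 2 by field; rewrite gt_eqF.
    by nra.
  by rewrite ler_wpM2r ?sqr_ge0 // ltW.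
have := largest_tail_le regG D2 p01 eta01 pD (ltn0Sn _) k16.
set P := expect p _ _; set P' := expect p _ _ => h.
have P'P : P' <= P.
  apply: le_expect => // S _; apply: ler_bool => AL.
  rewrite ltnNge; apply/negP => Lk; move: AL; rewrite ltNge => /negP; apply.
  apply: le_trans (_ : (Num.truncn (A * a ^+ 2))%:R <= _); first by rewrite ler_nat.
  by have /andP[] := truncn_itv Aa0.
have P0 : 0 <= P' by apply: expect_ge0.
rewrite ler_pdivlMr //; apply: (@le_trans _ _ (P * A)); first by rewrite ler_wpM2r // ltW.
have P00 := le_trans P0 P'P.
rewrite -(ler_pM2r a20); apply: (@le_trans _ _ (k%:R * P)).
  by rewrite -mulrA mulrC ler_wpM2r // ltW.
apply: (le_trans h); rewrite cardG le_eqVlt; apply/orP; left; apply/eqP.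
by field; rewrite gt_eqF.
Qed.

Lemma limf_esup_within_lty (R : realType) (I : set nat) (u : nat -> R) :
  (limf_esup (fun n => (u n)%:E) (within I \oo) < +oo)%E ->
  exists K N, 0 <= K /\ forall n, I n -> (N <= n)%N -> u n <= K.
Proof.
rewrite /limf_esup => /ereal_inf_lt[_ [V VI <-] supV].
have [N _ NV] : (\forall n \near \oo, I n -> V n) by exact: VI.
have ub n : I n -> (N <= n)%N -> ((u n)%:E <= ereal_sup [set (u k)%:E | k in V])%E.
  by move=> In Nn; apply: ereal_sup_ubound; exists n => //; exact: NV.
move: supV ub; case: (ereal_sup _) => // [s _ ub|_ ub].
  exists (Num.max 0 s), N; split; first by rewrite le_max lexx.
  by move=> n In Nn; rewrite le_max; apply/orP; right; rewrite -lee_fin ub.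
(* A supremum [-oo] is incompatible with any index [n >= N] in [I], so any bound will do. *)
by exists 0, N; split=> // n In Nn; have := ub n In Nn.
Qed.

Lemma perc_prob_between_ge (R : realType) (G : sgraph) (p lo lo' hi : R) :
  0 <= p <= 1 -> lo <= lo' ->
  1 - expect p (edges G) (fun S => ((largest_component_size S)%:R < lo')%R%:R)
    - expect p (edges G) (fun S => (hi < (largest_component_size S)%:R)%R%:R)
  <= perc_prob p (fun S : {set {set G}} =>
       lo <= (largest_component_size S)%:R <= hi).
Proof.
move=> p01 lolo'; rewrite perc_probE -{1}(expect_cst p (edges G) 1).
rewrite -!expectN -!expectD; apply: le_expect => // S _.
case: (ltP _ lo') => [_|hlo].
  by rewrite subrr sub0r (le_trans _ (ler0n _ _)) // oppr_le0.
case: (ltP hi _) => [_|hhi]; first by rewrite subr0 subrr.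
by rewrite !subr0 (le_trans lolo' hlo) /=.
Qed.

Theorem theorem1 (R : realType) (I : set nat) (G : nat -> sgraph)
    (d : nat -> nat) (v : forall n, G n) (lambda : R) :
  infinite_set I ->
  (forall n, I n -> (0 < n)%N) ->
  (forall n, I n -> #|G n| = n) ->
  (forall n, I n -> vertex_transitive (G n)) ->
  (forall n, I n -> regular (G n) (d n)) ->
  (forall n, I n -> (3 <= d n)%N) ->
  (limf_esup
     (fun n : nat => (n%:R `^ (1 / 3) *
        \sum_(1 <= t < (Num.truncn (n%:R `^ (1 / 3) : R)).+1)
           t%:R * nbrw_prob R (v n) t (v n))%:E)
     (within I \oo) < +oo)%E ->
  forall eps : R, 0 < eps ->
  exists A : R, 0 < A /\
    forall n, I n ->
      let p : R := (1 + lambda * n%:R `^ (- (1 / 3))) / ((d n)%:R - 1) in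
      0 <= p <= 1 ->
      1 - eps <= perc_prob p (fun S : {set {set G n}} =>
        n%:R `^ (2 / 3) / A <= (largest_component_size S)%:R
          <= A * n%:R `^ (2 / 3)).
Proof.
move=> _ I_gt0 cardG transG regG d3 /limf_esup_within_lty[K [N [K0 sumK]]] eps eps0.
have [c c_ge] : exists c : R, 2048 <= c by exists 2048.
have [b [b0 b_def]] : exists b : R, 0 <= b /\ b = 3 * (88 * 128) ^+ 2.
  by exists (3 * (88 * 128) ^+ 2); split=> //; rewrite mulr_ge0 ?exprn_ge0 ?mulr_ge0.
have c1 : 1 <= c by apply: le_trans c_ge; rewrite ler1n.
have lam0 : 0 <= `|lambda| by [].
(* This ensures [lambda <= H / 16], so [eta = H / a] is admissible in the upper tail. *)
pose H := 16 * (1 + `|lambda|).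
(* The summands serve in turn [M >= 1], the bound [5 K <= M], the comparison of [p'] with [p], and
   [b / M ^ 3 <= eps / 2]. *)
pose M := 1 + 5 * K + `|lambda| + 2 * b / eps.
have be0 : 0 <= 2 * b / eps by rewrite divr_ge0 ?mulr_ge0 // ltW.
have M1 : 1 <= M by rewrite /M; lra.
have H16 : 16 <= H by rewrite /H; lra.
pose B := c * M + H.
have cM0 : 0 <= c * M by rewrite mulr_ge0 //; lra.
have B16 : 16 <= B by rewrite /B; lra.
pose A := 1 + (c * M) ^+ 2 / 8 + 8 * H / eps + B ^+ 3 + N%:R.
have A_ge : [/\ 1 <= A, (c * M) ^+ 2 / 8 <= A, 8 * H / eps <= A & B ^+ 3 + N%:R <= A].
  have h1 : 0 <= (c * M) ^+ 2 / 8 by rewrite divr_ge0 ?exprn_ge0.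
  have h2 : 0 <= 8 * H / eps by rewrite divr_ge0 ?(ltW eps0) // mulr_ge0 //; lra.
  have h3 : 0 <= B ^+ 3 by rewrite exprn_ge0 //; lra.
  have h4 : 0 <= N%:R :> R by [].
  by rewrite /A; move: h1 h2 h3 h4; clear; move: (_ / 8) (_ / eps) (B ^+ 3) N%:R => w x y z *; split; lra.
have [A1 AM AH AB] := A_ge.
have A0 : 0 < A by exact: lt_le_trans ltr01 A1.
exists A; split=> // n In p p01.
have n0 := I_gt0 _ In.
pose a : R := n%:R `^ (1 / 3).
have a0 : 0 < a by rewrite powR_gt0 // ltr0n.
have a3 : a ^+ 3 = n%:R.
  rewrite -powR_mulrn ?(ltW a0) // -powRrM divfK ?powRr1 //.
have a2 : n%:R `^ (2 / 3) = a ^+ 2 :> R.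
  by rewrite -powR_mulrn ?(ltW a0) // -powRrM div1r mulrC.
have a1 : 1 <= a.
  rewrite leNgt; apply/negP => a_lt1.
  have : a ^+ 3 < 1 by rewrite exprn_ilt1 // ltW.
  by rewrite a3 ltNge ler1n n0.
rewrite a2.
(* For small [n] the event is certain: the largest component has between [1] and [n] vertices, and
   [a ^ 2 <= n <= A]. *)
have [small|large] := boolP ((n < N)%N || (a < B)).
  have nA : n%:R <= A.
    apply: le_trans AB; have B30 : 0 <= B ^+ 3 by rewrite exprn_ge0 //; lra.
    case/orP: small => [nN|aB].
      by rewrite -[leLHS]add0r lerD // ler_nat ltnW.
    rewrite -a3 -[leLHS]addr0 lerD //; apply: lerXn2r; rewrite ?nnegrE ?(ltW a0) ?(ltW aB) //; lra.
  rewrite perc_probE (@eq_expect _ _ _ _ _ (fun=> 1)) ?expect_cst; first by rewrite gerBl ltW.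
  move=> S _.
  have L1 : 1 <= (largest_component_size S)%:R :> R by rewrite ler1n (largest_gt0 _ (v n)).
  have Ln : (largest_component_size S)%:R <= n%:R :> R.
    by rewrite ler_nat -[leqRHS](cardG n In) largest_le_card.
  have a21 : 1 <= a ^+ 2 by rewrite exprn_ege1.
  have -> : a ^+ 2 / A <= (largest_component_size S)%:R.
    apply: le_trans L1; rewrite ler_pdivrMr // mul1r; apply: le_trans nA.
    by rewrite -a3 [leRHS]exprSr ler_peMr // exprn_ge0 // ltW.
  suff -> : (largest_component_size S)%:R <= A * a ^+ 2 by [].
  by apply: (le_trans Ln); apply: (le_trans nA); rewrite ler_peMr // ltW.
move: large; rewrite negb_or -leqNgt -leNgt => /andP[Nn Ba].
pose D := (d n).-1.
have dD : d n = D.+1 by rewrite /D prednK // (leq_trans _ (d3 n In)).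
have D2 : (2 <= D)%N by rewrite -ltnS -dD d3.
have regD : regular (G n) D.+1 by rewrite -dD; exact: regG.
have D0 : 0 < D%:R :> R by rewrite ltr0n (ltn_trans _ D2).
have pD : p * D%:R = 1 + lambda / a.
  have -> : D%:R = (d n)%:R - 1 :> R by rewrite dD -natr1 addrK.
  by rewrite /p powRN -/a divfK // dD -natr1 addrK gt_eqF.
have card : #|G n|%:R = a ^+ 3 by rewrite a3 cardG.
have Ha : H <= a by apply: le_trans Ba; rewrite /B lerDr.
have Ma : c * M <= a by apply: le_trans Ba; rewrite /B lerDl; lra.
have lamle : - `|lambda| <= lambda <= `|lambda| by rewrite -ler_norml.
have [lam1 lam2] := andP lamle.
have p1 : p <= 1 by case/andP: p01.
have pD_ge : 1 - M / a <= p * D%:R.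
  by rewrite pD lerD2l -mulNr ler_pM2r ?invr_gt0 // /M; lra.
have pD_le : p * D%:R <= 1 + H / a / 16.
  rewrite pD lerD2l mulrAC ler_pM2r ?invr_gt0 // /H; lra.
have KM : 5 * K <= M by rewrite /M; lra.
have low := largest_lower_tail regD D2 (transG n In) card p1 pD_ge M1 KM K0 c_ge Ma (sumK n In Nn).
have up := largest_upper_tail regD D2 card p01 pD_le H16 Ha A1.
apply: le_trans (perc_prob_between_ge _ _ p01 (_ : _ <= 8 * a ^+ 2 / (c * M) ^+ 2)); last first.
  have c0 : 0 < c by exact: lt_le_trans ltr01 c1.
  have M0 : 0 < M by exact: lt_le_trans ltr01 M1.
  have -> : 8 * a ^+ 2 / (c * M) ^+ 2 = a ^+ 2 / ((c * M) ^+ 2 / 8).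
    by field; rewrite !gt_eqF.
  rewrite ler_pM2l ?exprn_gt0 // lef_pV2 ?posrE //.
  by rewrite divr_gt0 // exprn_gt0 // mulr_gt0.
set PL := expect _ _ _ in low *; set PU := expect _ _ _ in up *.
rewrite -b_def in low.
have M0 : 0 < M by exact: lt_le_trans ltr01 M1.
have h1 : b / M ^+ 3 <= eps / 2.
  have M3 : M <= M ^+ 3 by rewrite ler_eXnr.
  have : 2 * b / eps <= M ^+ 3 by apply: le_trans M3; rewrite /M; lra.
  rewrite ler_pdivrMr // ler_pdivrMr ?exprn_gt0 //; lra.
have h2 : 4 * H / A <= eps / 2.
  by rewrite ler_pdivrMr //; move: AH; rewrite ler_pdivrMr //; lra.
move: low up; move: PL PU => x y; lra.
Qed.
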